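(* Let $S$ be a Damek--Ricci space with right Haar measure $\rho$ and left-invariant Riemannian distance $d$. The following families are nicely ordered: (i) the family $(\mathcal R^0,\le)$, where $B(x_2,r_2)\le B(x_1,r_1)$ if $r_2\le r_1$, and the dilated set of $B(x_0,r)$ is the ball $B(x_0,3r)$; (ii) the family $(\mathcal R^0,\le)$, where $B_2\le B_1$ if $\rho(B_2)\le2\rho(B_1)$, and the dilated set of $B(x_0,r)$ is the ball $B(x_0,\gamma r)$, where $\gamma=1+2\big(2\,\mathrm e^Q\gamma_2/\gamma_1\big)^{1/n}$; (iii) the family $(\mathcal R^\infty,\le)$, where $R_2\le R_1$ if $\rho(R_2)\le\rho(R_1)$, and the dilated set of $x_0E_{r,b}$ is $x_0\widetilde E_{r,b}$, with $\widetilde E_{r,b}=B_N(0_N,\gamma r^b)\times(r^{-\gamma},r^\gamma)$, where $\gamma$ is a constant greater than $\frac{4b''+2b'+1}{2b'-1}$; (iv) the family $(\mathcal D^\infty,\le)$, where $Q^{k_2}_{\alpha_2}\times(a_2/r_2,a_2r_2)\le Q^{k_1}_{\alpha_1}\times(a_1/r_1,a_1r_1)$ if $k_2\le k_1$, and the dilated set of $Q^k_\alpha\times(a_0/r,a_0r)$ is $Q^k_\alpha\times(a_0/r^\gamma,a_0r^\gamma)$, where $\gamma=\frac{9\beta+1}{\beta-1}$.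
   Context: **Nicely ordered families.** $(\mathcal F,\le)$, where $\mathcal F$ is a family of open subsets of $S$ and $\le$ is a preorder relation on $\mathcal F$, is nicely ordered if for each set $F\in\mathcal F$ there exists a set $\widetilde F$ (called the dilated set of $F$) such that: (1) $\rho(\widetilde F)\le\widetilde C\,\rho(F)$, where the constant $\widetilde C$ does not depend on $F$; (2) if $F_1,F_2\in\mathcal F$ are such that $F_2\le F_1$ and $F_2\cap F_1\ne\emptyset$, then $F_2\subseteq\widetilde F_1$. In the claim, each family is asserted to be nicely ordered with the indicated relation and the indicated dilated sets. **Damek--Ricci spaces.** Let $\mathfrak n$ be a finite-dimensional real Lie algebra with inner product and norm $|\cdot|$, and $\mathfrak n=\mathfrak v\oplus\mathfrak z$ an orthogonal decomposition with $[\mathfrak n,\mathfrak z]=\{0\}$, $[\mathfrak n,\mathfrak n]\subseteq\mathfrak z$. For $Z\in\mathfrak z$ define $J_Z:\mathfrak v\to\mathfrak v$ by $\langle J_ZX,Y\rangle=\langle Z,[X,Y]\rangle$. $\mathfrak n$ is of $H$-type if $|J_ZX|=|Z||X|$ for all $X\in\mathfrak v$, $Z\in\mathfrak z$ (the abelian case $\mathfrak v=\mathbb R^d$, $d\ge1$, $\mathfrak z=\{0\}$ is also allowed). $N=\mathfrak v\times\mathfrak z$ has product $(X,Z)(X',Z')=(X+X',Z+Z'+\frac12[X,X'])$, Haar measure $|\cdot|=dX\,dZ$, identity $0_N$, homogeneous norm $\mathcal N(X,Z)=(|X|^4/16+|Z|^2)^{1/4}$, distance $d_N(n,n')=\mathcal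 N(n^{-1}n')$, balls $B_N(n,r)$. $Q=(\dim\mathfrak v+2\dim\mathfrak z)/2$, $n=\dim\mathfrak v+\dim\mathfrak z+1$. $S=N\times\mathbb R^+$ has product $(X,Z,a)(X',Z',a')=(X+a^{1/2}X',Z+aZ'+\frac12a^{1/2}[X,X'],aa')$, identity $e=(0,0,1)$, right Haar measure $d\rho=a^{-1}dX\,dZ\,da$. $d$ is the left-invariant Riemannian distance whose metric at $e$ is the inner product of $\mathfrak n$ extended to $\mathfrak n\oplus\mathbb RH$ by making $H$ (tangent to $t\mapsto(0,0,e^t)$ at $t=0$) a unit vector orthogonal to $\mathfrak n$; $B(x,r)$ are its balls, $B_r=B(e,r)$. $\gamma_1,\gamma_2>0$ are constants such that $\gamma_1r^n\le\rho(B_r)\le\gamma_2r^n$ for all $r\in(0,1)$. **The families.** (a) $\mathcal R^0=\{B(x_0,r):x_0\in S,\ r<1/2\}$. (b) Fix $1/2<b'<b''$. $E_{r,b}=B_N(0_N,r^b)\times(1/r,r)$ for $r\ge\mathrm e$; $\mathcal R^\infty=\{x_0E_{r,b}:x_0\in S,\ r\ge\mathrm e,\ b'<b<b''\}$. (c) Dyadic sets (M. Christ): fix sets $Q^k_\alpha\subset N$, $k\in\mathbb Z$, $\alpha\in I_k$ ($I_k$ countable), constants $\eta>1$, $c_N,C_N>0$, an integer $M$, and points $n^k_\alpha\in N$ such that: $|N\setminus\bigcup_{\alpha\in I_k}Q^k_\alpha|=0$ for all $k$; $B_N(n^k_\alpha,c_N\eta^k)\subseteq Q^k_\alpha\subseteq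 B_N(n^k_\alpha,C_N\eta^k)$; $Q^k_\alpha\cap Q^k_\beta=\emptyset$ if $\alpha\ne\beta$; each $Q^k_\alpha$ has at most $M$ subsets of type $Q^{k-1}_\beta$; for $\ell\le k$, $\beta\in I_\ell$ there is a unique $\alpha\in I_k$ with $Q^\ell_\beta\subseteq Q^k_\alpha$; for $\ell\le k$ either $Q^k_\alpha\cap Q^\ell_\beta=\emptyset$ or $Q^\ell_\beta\subseteq Q^k_\alpha$. Let $c_3$ be a constant with $B(e,\log r)\subseteq B_N(0_N,c_3r)\times(1/r,r)$ for all $r>1$ and fix $\beta>\max\{3/2,1/4+\log\eta,1+\log(c_3/c_N)\}$. $\mathcal D^\infty$ is the family of big admissible sets, i.e. sets $Q^k_\alpha\times(a_0/r,a_0r)$ with $a_0>0$, $r\ge\mathrm e$, $a_0^{1/2}r^\beta\le\eta^k<a_0^{1/2}r^{4\beta}$.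
   Formalization: In (ii) the relation ρ(B₂) ≤ 2ρ(B₁) is not transitive, so it is not claimed to be a preorder, only openness and conditions (1), (2); in (iv) openness of the sets in D^∞ is claimed only when the dyadic sets Q^k_α are open. *)

(* Defs.v *)
From HB Require Import structures.
From mathcomp Require Import all_boot all_order all_algebra.
From mathcomp Require Import all_classical all_reals all_analysis.
Set Implicit Arguments.
Unset Strict Implicit.
Unset Printing Implicit Defensive.
Import Order.TTheory GRing.Theory Num.Theory.
Import numFieldNormedType.Exports.
Local Open Scope classical_set_scope.
Local Open Scope ring_scope.

(* Families of sets are indexed by parameters ranging over [D]; both the order *)
(* relation and the dilated sets may depend on the parameters, not only on the *)
(* sets (a dyadic set may be equal to Q^k_a for several values of k).          *)
Section nicely_ordered_families.
Context {R : realType} {T : topologicalType} {I : Type}.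
Implicit Types (D : set I) (F Ft : I -> set T) (le : I -> I -> Prop).

Definition open_family D F : Prop := forall i, D i -> open (F i).

Definition preorder_on D le : Prop :=
  (forall i, D i -> le i i) /\
  (forall i j k, D i -> D j -> D k -> le i j -> le j k -> le i k).

Definition nicely_ordered (rho : set T -> \bar R) D F le Ft : Prop :=
  (exists C : R, forall i, D i -> (rho (Ft i) <= C%:E * rho (F i))%E) /\
  (forall i1 i2, D i1 -> D i2 -> le i2 i1 ->
    F i2 `&` F i1 !=set0 -> F i2 `<=` Ft i1).

End nicely_ordered_families.

Section euclidean.
Context {R : realType}.

Definition dotv n (u v : 'rV[R]_n) : R := \sum_(i < n) u 0 i * v 0 i.

Definition enorm n (u : 'rV[R]_n) : R := Num.sqrt (dotv u u).

(* The Lebesgue integral over R^n of a nonnegative function, as n successive   *)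
(* integrals over R. It agrees with the integral for the n-dimensional         *)
(* Lebesgue measure on Borel functions (Tonelli), and it is monotone on all    *)
(* nonnegative functions.                                                      *)
Fixpoint integral_rV (n : nat) : ('rV[R]_n -> \bar R) -> \bar R :=
  match n with
  | 0 => fun f => f 0
  | m.+1 => fun f => (\int[lebesgue_measure]_t
      integral_rV (fun u : 'rV[R]_m => f (row_mx (t%:M : 'rV[R]_1) u)))%E
  end.

End euclidean.

Definition Qdim (R : realType) (dv dz : nat) : R := (dv + 2 * dz)%:R / 2.

Definition Sdim (dv dz : nat) : nat := (dv + dz + 1)%N.

Section damek_ricci.
Context {R : realType} {dv dz : nat}.

(* The Lie algebra n = v + z, in orthonormal coordinates of v and of z, and    *)
(* also the underlying set of the group N.                                     *)
Local Notation V := 'rV[R]_dv.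
Local Notation Z := 'rV[R]_dz.
Local Notation N := (V * Z)%type.
Local Notation G := (N * R)%type.

Variable br : N -> N -> N.

Definition brv (X Y : V) : Z := (br (X, 0) (Y, 0)).2.

Record Htype_algebra : Prop := {
  br_linearl : forall y : N, linear (fun x : N => br x y);
  br_linearr : forall x : N, linear (br x);
  br_alt : forall x : N, br x x = 0;
  br_jacobi : forall x y w : N,
    br x (br y w) + br y (br w x) + br w (br x y) = 0;
  br_center : forall (x : N) (W : Z), br x (0, W) = 0;
  br_derived : forall x y : N, (br x y).1 = 0;
  br_Htype : exists J : Z -> V -> V,
    (forall W X Y, dotv (J W X) Y = dotv W (brv X Y)) /\
    (forall W X, enorm (J W X) = enorm W * enorm X);
  br_abelian : dz = 0%N -> (1 <= dv)%N
}.

Definition Nmul (x y : N) : N :=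
  (x.1 + y.1, x.2 + y.2 + 2^-1 *: brv x.1 y.1).

Definition Nid : N := (0, 0).

Definition Ninv (x : N) : N := (- x.1, - x.2).

Definition Nnorm (x : N) : R :=
  (enorm x.1 ^+ 4 / 16 + enorm x.2 ^+ 2) `^ (4^-1).

Definition Ndist (x y : N) : R := Nnorm (Nmul (Ninv x) y).

Definition Nball (x : N) (r : R) : set N := [set y | Ndist x y < r].

(* dX dZ *)
Definition Nhaar (A : set N) : \bar R :=
  integral_rV (fun X : V => integral_rV (fun W : Z => (\1_A (X, W))%:E)).

(* S is the open half-space a > 0 of N x R. *)
Definition Sset : set G := [set x | 0 < x.2].

Definition Smul (x y : G) : G :=
  ((x.1.1 + Num.sqrt x.2 *: y.1.1,
    x.1.2 + x.2 *: y.1.2 + (2^-1 * Num.sqrt x.2) *: brv x.1.1 y.1.1),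
   x.2 * y.2).

Definition Sid : G := (Nid, 1).

Definition Sinv (x : G) : G :=
  ((- ((Num.sqrt x.2)^-1 *: x.1.1), - (x.2^-1 *: x.1.2)), x.2^-1).

(* a^-1 dX dZ da *)
Definition rho (A : set G) : \bar R :=
  (\int[lebesgue_measure]_(a in [set a : R | (0 < a)%R])
    ((a^-1)%:E * Nhaar [set x | A (x, a)]))%E.

(* The tangent space at the identity is n + RH, where H is the derivative of   *)
(* t |-> (0, 0, exp t) at 0, that is, the last coordinate vector.              *)
Definition tangent_norm (w : G) : R :=
  Num.sqrt (dotv w.1.1 w.1.1 + dotv w.1.2 w.1.2 + w.2 ^+ 2).

(* The norm of c'(t) for the left-invariant metric: c'(t) is carried back to   *)
(* the identity by the left translation by c(t)^-1.                            *)
Definition speed (c : R -> G) (t : R) : R :=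
  tangent_norm (derive1 (fun s => Smul (Sinv (c t)) (c s)) t).

(* Curves are parametrized by [0, 1]; a C^1 curve on [0, 1] is the restriction *)
(* of a C^1 function on R.                                                     *)
Definition C1_curve (c : R -> G) : Prop :=
  [/\ forall t, 0 <= t <= 1 -> Sset (c t),
      forall t, derivable c t 1
    & continuous (derive1 c)].

Definition curve_length (c : R -> G) : R :=
  (\int[lebesgue_measure]_(t in `[0, 1]) speed c t)%R.

(* [piecewise_C1 x y l]: some piecewise C^1 curve from x to y has length l. *)
Inductive piecewise_C1 : G -> G -> R -> Prop :=
| piecewise_nil x : Sset x -> piecewise_C1 x x 0
| piecewise_cons c y l : C1_curve c -> piecewise_C1 (c 1) y l ->
    piecewise_C1 (c 0) y (curve_length c + l).

Definition Sdist (x y : G) : R := inf [set l | piecewise_C1 x y l].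

Definition Sball (x : G) (r : R) : set G := [set y | Sset y /\ Sdist x y < r].

Definition Scyl (A : set N) (s t : R) : set G :=
  [set x | A x.1 /\ s < x.2 < t].

Definition ltrans (x : G) (A : set G) : set G := [set Smul x y | y in A].

(* The index of the ball B(x, r) is (x, r). *)
Definition R0_dom : set (G * R) := [set i | Sset i.1 /\ 0 < i.2 < 2^-1].

Definition R0_set (i : G * R) : set G := Sball i.1 i.2.

Definition E_set (r b : R) : set G := Scyl (Nball Nid (r `^ b)) r^-1 r.

Definition E_dil (g r b : R) : set G :=
  Scyl (Nball Nid (g * r `^ b)) (r `^ (- g)) (r `^ g).

(* The index of x E_{r, b} is (x, r, b). *)
Definition Rinf_dom (b' b'' : R) : set (G * R * R) :=
  [set i | [/\ Sset i.1.1, expR 1 <= i.1.2 & b' < i.2 < b'']].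

Definition Rinf_set (i : G * R * R) : set G := ltrans i.1.1 (E_set i.1.2 i.2).

Definition Rinf_dil (g : R) (i : G * R * R) : set G :=
  ltrans i.1.1 (E_dil g i.1.2 i.2).

Record dyadic_sets (I : int -> Type) (Q : forall k, I k -> set N)
    (eta cN CN : R) (M : nat) (ctr : forall k, I k -> N) : Prop := {
  dyadic_countable : forall k, countable [set: I k];
  dyadic_eta : 1 < eta;
  dyadic_cN : 0 < cN;
  dyadic_CN : 0 < CN;
  dyadic_cover : forall k, Nhaar (~` \bigcup_(a in [set: I k]) Q k a) = 0%E;
  dyadic_inner : forall k a, Nball (ctr k a) (cN * eta ^ k) `<=` Q k a;
  dyadic_outer : forall k a, Q k a `<=` Nball (ctr k a) (CN * eta ^ k);
  dyadic_disjoint : forall k a b, a <> b -> Q k a `&` Q k b = set0;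
  dyadic_children : forall k a,
    ([set b | Q (k - 1) b `<=` Q k a] #<= `I_M)%card;
  dyadic_parent : forall l k, l <= k -> forall b : I l,
    exists! a : I k, Q l b `<=` Q k a;
  dyadic_nested : forall l k, l <= k -> forall (a : I k) (b : I l),
    Q k a `&` Q l b = set0 \/ Q l b `<=` Q k a
}.

(* The index of Q^k_alpha x (a / r, a r) is ((k, alpha), a, r). *)
Definition Dinf_dom (I : int -> Type) (eta beta : R) :
    set ({k : int & I k} * R * R) :=
  [set i | [/\ 0 < i.1.2, expR 1 <= i.2
     & Num.sqrt i.1.2 * i.2 `^ beta <= eta ^ projT1 i.1.1
         < Num.sqrt i.1.2 * i.2 `^ (4 * beta)]].

Definition Dinf_set (I : int -> Type) (Q : forall k, I k -> set N)
    (i : {k : int & I k} * R * R) : set G :=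
  Scyl (Q _ (projT2 i.1.1)) (i.1.2 / i.2) (i.1.2 * i.2).

Definition Dinf_dil (I : int -> Type) (Q : forall k, I k -> set N) (g : R)
    (i : {k : int & I k} * R * R) : set G :=
  Scyl (Q _ (projT2 i.1.1)) (i.1.2 / i.2 `^ g) (i.1.2 * i.2 `^ g).

End damek_ricci.

(* Main.v *)
(** Left translation by (X, Z, a) multiplies rho by a^Q, and the gauge N on the
    group N is subadditive (Cygan), since <X, Y>^2 + |[X, Y]|^2 <= |X|^2 |Y|^2 in
    an H-type algebra. Along a curve, ln a varies by at most the length and
    ln (a^2 + |X|^4 + |Z|^2) by at most eight times the length. The second bound
    encloses each ball in a cylinder of finite measure; the first says that the
    heights of intersecting small balls are comparable, so that the comparison of
    measures becomes a comparison of radii. If x_1 E_1 and x_2 E_2 have a common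
    point y, then x_1^-1 x_2 = u p^-1 with u = x_1^-1 y in E_1 and p = x_2^-1 y in
    E_2, so x_2 E_2 is a subset of x_1 (E_1 E_2^-1 E_2), and the comparison of
    measures bounds the last factor. For dyadic sets, the comparison of the k's
    bounds r_2 by a power of r_1. *)
Require Import Defs.
From HB Require Import structures.
From mathcomp Require Import all_boot all_order all_algebra.
From mathcomp Require Import all_classical all_reals all_analysis.
From mathcomp Require Import measurable_realfun ring lra.
Set Implicit Arguments.
Unset Strict Implicit.
Unset Printing Implicit Defensive.
Import Order.TTheory GRing.Theory Num.Theory.
Import numFieldNormedType.Exports.
Local Open Scope classical_set_scope.
Local Open Scope ring_scope.

(** [rho] is an iterated integral over sections of arbitrary sets, among them Riemannian balls,
    whose measurability is not established. The argument therefore rests on three properties that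
    the integral of a nonnegative function has as a supremum over simple functions: monotonicity,
    homogeneity and affine substitution. Explicit values are computed for cylinders, whose sections
    do not vary with the height, and carried over to their translates. The distance is an infimum of
    lengths, with no minimizing curve at hand. Lower bounds come from functions whose derivative
    along a curve is at most a multiple of the speed; upper bounds come from straight segments, S
    being convex in its coordinates. The Haar measure of the unit ball of N is not computed: its
    positivity and finiteness are extracted from the bounds on rho(B_r) at r = 1/2. These bounds
    hold for r < 1, while a dilated ball in (i) or (ii) may be larger. The threshold for gamma in
    (iii) is 1 + 2 theta with theta = (2 b'' + 1) / (2 b' - 1): the summand 1 accounts for E_1, and
    theta for each of the factors E_2^-1 and E_2. *)

(** * Integrals over the line of arbitrary nonnegative functions *)

Section integral_ge0_nonmeasurable.
Context {R : realType}.
Notation mu := (@lebesgue_measure R).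
Implicit Types f g : R -> \bar R.

Import HBNNSimple.

Lemma le_integralT f g : (forall x, 0 <= f x)%E -> (forall x, f x <= g x)%E ->
  (\int[mu]_x f x <= \int[mu]_x g x)%E.
Proof.
move=> f0 fg; have g0 x : (0 <= g x)%E by exact: le_trans (f0 x) (fg x).
rewrite !ge0_integralTE//; apply: le_ereal_sup => _ [h /= hf <-].
by exists h => // x; exact: le_trans (hf x) (fg x).
Qed.

(** A simple function below k g, divided by k, is a simple function below g. This gives one
    inequality for every k > 0; applied to c^-1 and c f it gives the converse one. *)
Lemma ge0_integralTZl f (c : R) : 0 < c -> (forall x, 0 <= f x)%E ->
  (\int[mu]_x (c%:E * f x) = c%:E * \int[mu]_x f x)%E.
Proof.
have half g (k : R) : 0 < k -> (forall x, 0 <= g x)%E ->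
    (\int[mu]_x (k%:E * g x) <= k%:E * \int[mu]_x g x)%E.
  move=> k0 g0; have kg0 x : (0 <= k%:E * g x)%E by rewrite mule_ge0// lee_fin ltW.
  rewrite !ge0_integralTE//; apply: ge_ereal_sup => _ [h /= hg <-].
  have ki0 : 0 <= k^-1 by rewrite invr_ge0 ltW.
  rewrite -lee_pdivrMl//.
  apply: ereal_sup_ubound; exists (scale_nnsfun h ki0) => [x|] /=.
    by rewrite /= EFinM lee_pdivrMl//; exact: hg.
  exact: (sintegralrM mu k^-1 h).
move=> c0 f0; apply/eqP; rewrite eq_le half//=.
have -> : (\int[mu]_x f x = \int[mu]_x ((c^-1)%:E * (c%:E * f x)))%E.
  by apply: eq_integral => x _; rewrite muleA -EFinM mulVf ?mul1e// gt_eqF.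
rewrite -lee_pdivlMl//; apply: half; first by rewrite invr_gt0.
by move=> x; rewrite mule_ge0// lee_fin ltW.
Qed.

(** The measure sending A to c times the measure of its preimage agrees with Lebesgue measure on
    half-open intervals, hence on all measurable sets. *)
Lemma lebesgue_measure_affine (c d : R) (A : set R) : 0 < c -> measurable A ->
  mu ((fun t => c * t + d) @^-1` A) = ((c^-1)%:E * mu A)%E.
Proof.
move=> c0 mA.
pose phi : measurableTypeR R -> measurableTypeR R := fun t => c * t + d.
have mphi : measurable_fun [set: measurableTypeR R] phi.
  apply: measurable_funD; last exact: measurable_cst.
  exact: mulrl_measurable.
pose m := mscale (NngNum (ltW c0)) (pushforward mu phi).
have E : forall A, measurable A -> mu A = m mphi A.
  apply: lebesgue_measure_unique => _ [[a b] _ <-] /=.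
  rewrite /m /mscale /= /pushforward.
  have -> : phi @^-1` `]a, b]%classic = `](a - d) / c, (b - d) / c]%classic.
    apply/seteqP; split => x /=; rewrite !in_itv/= /phi.
      by rewrite ltr_pdivrMr// ler_pdivlMr// ltrBlDr lerBrDr mulrC.
    by rewrite ltr_pdivrMr// ler_pdivlMr// ltrBlDr lerBrDr mulrC.
  rewrite !lebesgue_measure_itv/= !lte_fin ltr_pM2r ?invr_gt0// ltrD2r.
  case: ifP => _; last by rewrite mule0.
  rewrite -!EFinB -EFinM; congr EFin; field.
  by rewrite gt_eqF.
have := E A mA; rewrite /m /mscale /= /pushforward => ->.
by rewrite muleA -EFinM mulVf ?mul1e// gt_eqF.
Qed.

(** If a simple h lies below t |-> g (k t + e), then h composed with the inverse substitution [psi]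
    is simple and lies below g, and its level sets are k times as large. The converse inequality is
    the same one for the inverse substitution. *)
Lemma ge0_integralT_affine f (c d : R) : 0 < c -> (forall x, 0 <= f x)%E ->
  (\int[mu]_x f (c * x + d)%R = (c^-1)%:E * \int[mu]_x f x)%E.
Proof.
have half g (k e : R) : 0 < k -> (forall x, 0 <= g x)%E ->
    (\int[mu]_x g (k * x + e)%R <= (k^-1)%:E * \int[mu]_x g x)%E.
  move=> k0 g0; rewrite !ge0_integralTE//; apply: ge_ereal_sup => _ [h /= hg <-].
  rewrite lee_pdivlMl//; apply: ereal_sup_ubound => /=.
  pose psi : measurableTypeR R -> measurableTypeR R := fun t => k^-1 * t + - (e / k).
  have psiE x : k * psi x + e = x by rewrite /psi; field; rewrite gt_eqF.
  have mpsi : measurable_fun [set: measurableTypeR R] psi.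
    by apply: measurable_funD; [exact: mulrl_measurable | exact: measurable_cst].
  have mh : measurable_fun [set: measurableTypeR R] (h \o psi).
    exact: measurableT_comp.
  have fh : finite_set (range (h \o psi)).
    apply: (@sub_finite_set _ _ (range h)); last exact: fimfunP.
    by move=> _ [x _ <-]; exists (psi x).
  have h0 x : 0 <= (h \o psi) x by exact: fun_ge0.
  pose H : {nnsfun measurableTypeR R >-> R} := HB.pack (h \o psi)
    (isMeasurableFun.Build _ _ _ _ (h \o psi) mh)
    (FiniteImage.Build _ _ (h \o psi) fh)
    (isNonNegFun.Build _ _ (h \o psi) h0).
  exists H => [x|]; first by rewrite -[in leRHS](psiE x); exact: hg.
  rewrite !sintegralET ge0_mule_fsumr; last exact: nnsfun_mulemu_ge0.
  apply: eq_fsbigr => r _; rewrite muleCA; congr (_ * _)%E.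
  rewrite -[H @^-1` _]/(psi @^-1` (h @^-1` [set r])).
  rewrite lebesgue_measure_affine ?invr_gt0// ?invrK//.
  exact: (@measurable_sfunP _ _ _ _ h [set r] (measurable_set1 r)).
move=> c0 f0; apply/eqP; rewrite eq_le half//=.
rewrite -lee_pdivlMl ?invr_gt0// ?invrK.
have -> : (\int[mu]_x f x = \int[mu]_x f (c * (c^-1 * x + - (d / c)) + d)%R)%E.
  by apply: eq_integral => x _; congr f; field; rewrite gt_eqF.
apply: le_trans (half (fun t => f (c * t + d)) _ _ _ _) _ => //.
  by rewrite invr_gt0.
by rewrite invrK.
Qed.

End integral_ge0_nonmeasurable.

(** * Iterated integrals over R^n *)

Section integral_rV_theory.
Context {R : realType}.

Lemma integral_rV_ge0 n (f : 'rV[R]_n -> \bar R) :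
  (forall u, 0 <= f u)%E -> (0 <= integral_rV f)%E.
Proof.
elim: n f => [|n IH] f f0 /=; first exact: f0.
by apply: integral_ge0 => t _; apply: IH => u; exact: f0.
Qed.

Lemma le_integral_rV n (f g : 'rV[R]_n -> \bar R) :
  (forall u, 0 <= f u)%E -> (forall u, f u <= g u)%E ->
  (integral_rV f <= integral_rV g)%E.
Proof.
elim: n f g => [|n IH] f g f0 fg /=; first exact: fg.
apply: le_integralT => t; last by apply: IH => u; [exact: f0 | exact: fg].
by apply: integral_rV_ge0 => u; exact: f0.
Qed.

Lemma integral_rV_eq0 n (f : 'rV[R]_n -> \bar R) :
  (forall u, f u = 0%E) -> integral_rV f = 0%E.
Proof.
elim: n f => [|n IH] f f0 /=; first exact: f0.
by apply: integral0_eq => t _; apply: IH => u; exact: f0.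
Qed.

Lemma integral_rVZl n (c : R) (f : 'rV[R]_n -> \bar R) : 0 < c ->
  (forall u, 0 <= f u)%E ->
  (integral_rV (fun u => c%:E * f u) = c%:E * integral_rV f)%E.
Proof.
move=> c0; elim: n f => [//|n IH] f f0 /=.
rewrite -ge0_integralTZl//; last first.
  by move=> t; apply: integral_rV_ge0 => u; exact: f0.
apply: eq_integral => t _; apply: IH => u; exact: f0.
Qed.

Lemma integral_rV_affine n (c : R) (v : 'rV[R]_n) (f : 'rV[R]_n -> \bar R) :
  0 < c -> (forall u, 0 <= f u)%E ->
  (integral_rV (fun u => f (c *: u + v)%R) = (c ^- n)%:E * integral_rV f)%E.
Proof.
move=> c0; elim: n v f => [|n IH] v f f0 /=.
  by rewrite expr0 invr1 mul1e; congr f; apply/matrixP => i [].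
pose v' := v : 'rV[R]_(1 + n).
pose g t := integral_rV (fun u : 'rV[R]_n => f (row_mx (t%:M : 'rV[R]_1) u)).
have g0 t : (0 <= g t)%E by apply: integral_rV_ge0 => u; exact: f0.
have cn0 : 0 < c ^- n by rewrite invr_gt0 exprn_gt0.
transitivity (\int[lebesgue_measure]_t ((c ^- n)%:E * g (c * t + lsubmx v' 0 0)%R))%E.
  apply: eq_integral => t _.
  rewrite -(IH (rsubmx v') 
    (fun u => f (row_mx ((c * t + lsubmx v' 0 0)%:M : 'rV[R]_1) u)));
      last by move=> u; exact: f0.
  congr integral_rV; apply/funext => u; congr f.
  rewrite -[LHS]/(c *: row_mx t%:M u + v') -[v' in LHS]hsubmxK.
  rewrite scale_row_mx add_row_mx scale_scalar_mx.
  by rewrite {1}[lsubmx v']mx11_scalar -raddfD.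
rewrite ge0_integralTZl// ge0_integralT_affine// muleA -EFinM.
by rewrite exprSr invfM mulrC.
Qed.

End integral_rV_theory.

(** * The measures [Nhaar] and [rho] *)

Section Nhaar_rho.
Context {R : realType} {dv dz : nat}.
Local Notation V := 'rV[R]_dv.
Local Notation Z := 'rV[R]_dz.
Local Notation N := (V * Z)%type.
Local Notation G := (N * R)%type.

Lemma Nhaar_ge0 (A : set N) : (0 <= Nhaar A)%E.
Proof. by do 2!(apply: integral_rV_ge0 => ?); rewrite lee_fin. Qed.

Lemma le_indic (T : Type) (A B : set T) x : A `<=` B ->
  (\1_A x <= \1_B x :> R).
Proof.
move=> AB; rewrite !indicE; case: (boolP (x \in A)) => [|_]; last exact: ler0n.
by rewrite !inE => /AB Bx; rewrite mem_set.
Qed.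

Lemma le_Nhaar (A B : set N) : A `<=` B -> (Nhaar A <= Nhaar B)%E.
Proof.
move=> AB; apply: le_integral_rV => X.
  by apply: integral_rV_ge0 => ?; rewrite lee_fin.
by apply: le_integral_rV => W; rewrite lee_fin //; exact: le_indic.
Qed.

(** The shift of Z may depend on X because a left translation shears Z by a bracket with X. The
    inner integral, taken at fixed X, sees only a translation, so [W0] may be any function. *)
Lemma Nhaar_affine (s t : R) (X0 : V) (W0 : V -> Z) (A : set N) :
  0 < s -> 0 < t ->
  Nhaar [set y | A (s *: y.1 + X0, t *: y.2 + W0 y.1)] =
  ((s ^- dv * t ^- dz)%:E * Nhaar A)%E.
Proof.
move=> s0 t0; have tz : 0 < t ^- dz by rewrite invr_gt0 exprn_gt0.
pose h X := integral_rV (fun W : Z => (\1_A (X, W))%:E : \bar R).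
have h0 X : (0 <= h X)%E by apply: integral_rV_ge0 => ?; rewrite lee_fin.
transitivity (integral_rV (fun X : V => (t ^- dz)%:E * h (s *: X + X0)%R)%E).
  congr integral_rV; apply/funext => X.
  rewrite -(integral_rV_affine (W0 X) (f := fun W => (\1_A (s *: X + X0, W))%:E))//.
by rewrite integral_rVZl// integral_rV_affine// muleA -EFinM mulrC.
Qed.

(** The integrand extended by zero to the whole line, where the integral lemmas above apply. *)
Let rho_fun (A : set G) : R -> \bar R :=
  (fun a => (a^-1)%:E * Nhaar [set x | A (x, a)])%E \_ [set a | 0 < a].

Let rhoE (A : set G) : rho A = (\int[lebesgue_measure]_a rho_fun A a)%E.
Proof. by rewrite /rho integral_mkcond. Qed.

Let rho_fun_ge0 A a : (0 <= rho_fun A a)%E.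
Proof.
apply: erestrict_ge0 => {}a /= a0.
by rewrite mule_ge0 ?Nhaar_ge0// lee_fin invr_ge0 ltW.
Qed.

Lemma le_rho (A B : set G) : A `<=` B -> (rho A <= rho B)%E.
Proof.
move=> AB; rewrite !rhoE; apply: le_integralT => // a.
rewrite /rho_fun /patch; case: ifP => //; rewrite inE /= => a0.
apply: lee_wpmul2l; first by rewrite lee_fin invr_ge0 ltW.
by apply: le_Nhaar => x /=; exact: AB.
Qed.

(** The measure da / a is invariant under a |-> c a: the factor c in 1/a = c / (c a) cancels the
    c^-1 of the substitution. Only the Jacobian on N remains. *)
Lemma rho_dilation (s t c : R) (X0 : V) (W0 : V -> Z) (A : set G) :
  0 < s -> 0 < t -> 0 < c ->
  rho [set y | A ((s *: y.1.1 + X0, t *: y.1.2 + W0 y.1.1), c * y.2)] =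
  ((s ^- dv * t ^- dz)%:E * rho A)%E.
Proof.
move=> s0 t0 c0; have st : 0 < s ^- dv * t ^- dz.
  by rewrite mulr_gt0// invr_gt0 exprn_gt0.
transitivity
  (\int[lebesgue_measure]_a ((s ^- dv * t ^- dz * c)%:E * rho_fun A (c * a + 0)%R))%E.
  rewrite rhoE; apply: eq_integral => a _.
  have ca : (c * a \in [set x : R | 0 < x]) = (a \in [set x : R | 0 < x]).
    by apply/idP/idP; rewrite !inE /= pmulr_rgt0.
  rewrite /rho_fun /patch addr0 ca; case: ifP => _; last by rewrite mule0.
  rewrite (@Nhaar_affine s t X0 W0 [set x | A (x, c * a)])//.
  rewrite [in RHS]muleA -EFinM invfM mulrA mulfK ?gt_eqF//.
  by rewrite muleA -EFinM [X in X%:E]mulrC.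
rewrite ge0_integralTZl//; last exact: mulr_gt0.
by rewrite ge0_integralT_affine// rhoE muleA -EFinM mulfK ?gt_eqF.
Qed.

Lemma rho_Scyl (A : set N) (s t : R) : 0 < s -> s < t ->
  rho (Scyl A s t) = ((ln t - ln s)%:E * Nhaar A)%E.
Proof.
move=> s0 st.
have -> : rho (Scyl A s t) =
    (\int[lebesgue_measure]_(a in `]s, t[) ((a^-1)%:E * Nhaar A))%E.
  rewrite rhoE [in RHS]integral_mkcond; apply: eq_integral => a _.
  rewrite /rho_fun /patch; have [h|h] := boolP (s < a < t).
    have a0 : 0 < a by case/andP: h => sa _; exact: lt_trans sa.
    rewrite [in LHS]ifT ?inE// [in RHS]ifT; last by rewrite inE/= in_itv.
    by congr (_ * Nhaar _)%E; apply/seteqP; split => x //= -[].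
  rewrite [in RHS]ifF; last by apply/negP; rewrite inE/= in_itv; exact/negP.
  case: ifP => // _; rewrite (_ : [set x | _] = set0); last first.
    by apply/seteqP; split => x //= -[_ /= h']; rewrite h' in h.
  rewrite (_ : Nhaar set0 = 0%E) ?mule0//.
  by do 2!(apply: integral_rV_eq0 => ?); rewrite indic0.
have cV x : s <= x -> {for x, continuous (fun y : R => y^-1)}.
  by move=> sx; apply: continuousV;
    [rewrite gt_eqF// (lt_le_trans s0) | exact: cvg_id].
have mV : measurable_fun `]s, t[ (fun a : R => (a^-1)%:E).
  apply/measurable_EFinP; apply: subspace_continuous_measurable_fun => //.
  apply: continuous_in_subspaceT => x; rewrite inE/= in_itv/= => /andP[sx _].
  exact/cV/ltW.
rewrite ge0_integralZr//; last 2 first.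
- by move=> x /=; rewrite in_itv/= => /andP[sx _];
  rewrite lee_fin invr_ge0 ltW// (lt_trans s0).
- exact: Nhaar_ge0.
congr (_ * _)%E.
rewrite -(@integral_itv_bndoo _ _ _ _ true false)//.
rewrite (@continuous_FTC2 _ _ (@ln R))//.
- apply: continuous_in_subspaceT => x; rewrite inE/= in_itv/= => /andP[sx _].
  exact: cV.
- split.
  + move=> x; rewrite in_itv/= => /andP[sx _].
    have x0 := lt_trans s0 sx.
    by have /@ex_derive := is_derive1_ln x0.
  + apply: cvg_at_right_filter; exact: continuous_ln.
  + by apply: cvg_at_left_filter; apply: continuous_ln; exact: lt_trans st.
- move=> x; rewrite in_itv/= => /andP[sx _].
  by rewrite derive1E; apply: derive_val; apply: is_derive1_ln; exact: lt_trans sx.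
Qed.

End Nhaar_rho.

(** * Inner product and norm on R^n *)

Section euclidean_theory.
Context {R : realType}.

Section dot.
Variable n : nat.
Implicit Types (u v w : 'rV[R]_n) (c : R).

Lemma dotvC u v : dotv u v = dotv v u.
Proof. by apply: eq_bigr => i _; rewrite mulrC. Qed.

Lemma dotvDl u v w : dotv (u + v) w = dotv u w + dotv v w.
Proof. by rewrite -big_split; apply: eq_bigr => i _; rewrite mxE mulrDl. Qed.

Lemma dotvZl c u v : dotv (c *: u) v = c * dotv u v.
Proof. by rewrite mulr_sumr; apply: eq_bigr => i _; rewrite mxE mulrA. Qed.

Lemma dotvDr u v w : dotv u (v + w) = dotv u v + dotv u w.
Proof. by rewrite dotvC dotvDl !(dotvC u). Qed.

Lemma dotvZr c u v : dotv u (c *: v) = c * dotv u v.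
Proof. by rewrite dotvC dotvZl dotvC. Qed.

Lemma dotv0l u : dotv 0 u = 0.
Proof. by rewrite -(scale0r u) dotvZl mul0r. Qed.

Lemma dotv_ge0 u : 0 <= dotv u u.
Proof. by apply: sumr_ge0 => i _; rewrite -expr2 sqr_ge0. Qed.

Lemma sqr_enorm u : enorm u ^+ 2 = dotv u u.
Proof. by rewrite sqr_sqrtr// dotv_ge0. Qed.

Lemma enorm_ge0 u : 0 <= enorm u.
Proof. exact: sqrtr_ge0. Qed.

Lemma enormZ c u : enorm (c *: u) = `|c| * enorm u.
Proof.
by rewrite /enorm dotvZl dotvZr mulrA -expr2 sqrtrM ?sqr_ge0// sqrtr_sqr.
Qed.

Lemma enormN u : enorm (- u) = enorm u.
Proof. by rewrite -scaleN1r enormZ normrN1 mul1r. Qed.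

Lemma coord_le_enorm u i : `|u 0 i| <= enorm u.
Proof.
rewrite -sqrtr_sqr ler_sqrt ?dotv_ge0// /dotv (bigD1 i)//= expr2 lerDl.
by apply: sumr_ge0 => j _; rewrite -expr2 sqr_ge0.
Qed.

Lemma Cauchy_Schwarz_sqr u v : dotv u v ^+ 2 <= dotv u u * dotv v v.
Proof.
have [v0|v0] := eqVneq (dotv v v) 0.
  have -> : dotv u v = 0.
    apply: big1 => i _; suff -> : v 0 i = 0 by rewrite mulr0.
    apply/eqP; rewrite -normr_le0 (le_trans (coord_le_enorm v i))//.
    by rewrite /enorm v0 sqrtr0.
  by rewrite expr0n/= v0 mulr0.
have vp : 0 < dotv v v by rewrite lt_def v0 dotv_ge0.
have := dotv_ge0 (dotv v v *: u + (- dotv u v) *: v).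
rewrite !dotvDl !dotvDr !dotvZl !dotvZr (dotvC v u) => h.
rewrite -subr_ge0 -(pmulr_rge0 _ vp); apply: le_trans h _; rewrite le_eqVlt.
by apply/orP; left; apply/eqP; ring.
Qed.

Lemma Cauchy_Schwarz u v : `|dotv u v| <= enorm u * enorm v.
Proof.
rewrite -(@ler_pXn2r _ 2)// ?nnegrE ?mulr_ge0 ?enorm_ge0//.
by rewrite exprMn !sqr_enorm -normrX ger0_norm ?sqr_ge0// Cauchy_Schwarz_sqr.
Qed.

Lemma enormD u v : enorm (u + v) <= enorm u + enorm v.
Proof.
rewrite -(@ler_pXn2r _ 2)// ?nnegrE ?addr_ge0 ?enorm_ge0//.
rewrite sqrrD !sqr_enorm dotvDl !dotvDr (dotvC v u).
have := le_trans (ler_norm _) (Cauchy_Schwarz u v); lra.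
Qed.

End dot.

Lemma dotv_row_mx m n (a c : 'rV[R]_m) (b d : 'rV[R]_n) :
  dotv (row_mx a b) (row_mx c d) = dotv a c + dotv b d.
Proof.
rewrite /dotv big_split_ord; congr (_ + _); apply: eq_bigr => i _.
  by rewrite !row_mxEl.
by rewrite !row_mxEr.
Qed.

Lemma dotv_scalar (a b : R) : dotv (a%:M : 'rV[R]_1) b%:M = a * b.
Proof. by rewrite /dotv big_ord1 !mxE !mulr1n. Qed.

End euclidean_theory.

(** * The H-type group N, its gauge, and left translations of S *)

Section Htype_group.
Context {R : realType} {dv dz : nat}.
Local Notation V := 'rV[R]_dv.
Local Notation Z := 'rV[R]_dz.
Local Notation N := (V * Z)%type.
Local Notation G := (N * R)%type.

Variable br : N -> N -> N.
Hypothesis hbr : Htype_algebra br.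
Local Notation brv := (brv br).
Local Notation Nmul := (Nmul br).
Local Notation Smul := (Smul br).

Lemma brv_linearl c (X X' Y : V) : brv (c *: X + X') Y = c *: brv X Y + brv X' Y.
Proof.
rewrite /brv; have := br_linearl hbr (Y, 0) c (X, 0) (X', 0) => /=.
by rewrite -[c *: (X, 0) + (X', 0)]/((c *: X + X', c *: 0 + 0)) scaler0 addr0 => ->.
Qed.

Lemma brv_linearr c (X Y Y' : V) : brv X (c *: Y + Y') = c *: brv X Y + brv X Y'.
Proof.
rewrite /brv; have := br_linearr hbr (X, 0) c (Y, 0) (Y', 0) => /=.
by rewrite -[c *: (Y, 0) + (Y', 0)]/((c *: Y + Y', c *: 0 + 0)) scaler0 addr0 => ->.
Qed.

Lemma brvDl X X' Y : brv (X + X') Y = brv X Y + brv X' Y.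
Proof. by have := brv_linearl 1 X X' Y; rewrite !scale1r. Qed.

Lemma brvDr X Y Y' : brv X (Y + Y') = brv X Y + brv X Y'.
Proof. by have := brv_linearr 1 X Y Y'; rewrite !scale1r. Qed.

Lemma brv0l Y : brv 0 Y = 0.
Proof. by apply: (addrI (brv 0 Y)); rewrite -brvDl !addr0. Qed.

Lemma brv0r X : brv X 0 = 0.
Proof. by apply: (addrI (brv X 0)); rewrite -brvDr !addr0. Qed.

Lemma brvZl c X Y : brv (c *: X) Y = c *: brv X Y.
Proof. by rewrite -[c *: X]addr0 brv_linearl brv0l addr0. Qed.

Lemma brvZr c X Y : brv X (c *: Y) = c *: brv X Y.
Proof. by rewrite -[c *: Y]addr0 brv_linearr brv0r addr0. Qed.

Lemma brvNl X Y : brv (- X) Y = - brv X Y.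
Proof. by rewrite -scaleN1r brvZl scaleN1r. Qed.

Lemma brvNr X Y : brv X (- Y) = - brv X Y.
Proof. by rewrite -scaleN1r brvZr scaleN1r. Qed.

Lemma brvv X : brv X X = 0.
Proof. by rewrite /brv br_alt. Qed.

Definition brvE := (brvDl, brvDr, brvNl, brvNr, brvZl, brvZr, brvv, brv0l, brv0r).

(* For T = [X, Y], the vectors |T| X and J_T X are orthogonal of equal norm,    *)
(* and their inner products with Y are |T| <X, Y> and |T|^2: this is Bessel's  *)
(* inequality for Y.                                                           *)
Lemma brv_Bessel X Y :
  dotv X Y ^+ 2 + dotv (brv X Y) (brv X Y) <= dotv X X * dotv Y Y.
Proof.
have [J [JE Jn]] := br_Htype hbr.
set T := brv X Y; set U := J T X.
have UU : dotv U U = dotv T T * dotv X X by rewrite -!sqr_enorm Jn exprMn.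
have UX : dotv X U = 0 by rewrite dotvC JE brvv dotvC dotv0l.
have UY : dotv U Y = dotv T T by rewrite JE.
set p := dotv X Y; set q := dotv T T.
have q0 : 0 <= q by exact: dotv_ge0.
have [X0|X0] := eqVneq (dotv X X) 0.
  have := Cauchy_Schwarz_sqr U Y; rewrite UU UY -/q X0 mulr0 !mul0r => q20.
  have := Cauchy_Schwarz_sqr X Y; rewrite X0 mul0r -/p => p20.
  have q00 : q = 0 by apply/eqP; rewrite -sqrf_eq0 eq_le q20 sqr_ge0.
  by rewrite q00 addr0.
have Xp : 0 < dotv X X by rewrite lt_def X0 dotv_ge0.
have := dotv_ge0 (dotv X X *: Y + ((- p) *: X + (- 1) *: U)).
rewrite !dotvDl !dotvDr !dotvZl !dotvZr UU UX (dotvC U X) UX UY.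
rewrite (dotvC Y U) UY (dotvC Y X) -/p -/q => h.
rewrite -subr_ge0 -(pmulr_rge0 _ Xp); apply: le_trans h _; rewrite le_eqVlt.
by apply/orP; left; apply/eqP; ring.
Qed.

Lemma enorm_brv X Y : enorm (brv X Y) <= enorm X * enorm Y.
Proof.
rewrite -(@ler_pXn2r _ 2)// ?nnegrE ?mulr_ge0 ?enorm_ge0//.
rewrite exprMn !sqr_enorm; apply: le_trans _ (brv_Bessel X Y).
by rewrite lerDr sqr_ge0.
Qed.

Lemma Nnorm_ge0 (x : N) : 0 <= Nnorm x.
Proof. exact: powR_ge0. Qed.

Lemma Nnorm_exp4 (x : N) : Nnorm x ^+ 4 = enorm x.1 ^+ 4 / 16 + enorm x.2 ^+ 2.
Proof.
rewrite -powR_mulrn ?Nnorm_ge0// /Nnorm -powRrM mulVf// powRr1//.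
by rewrite addr_ge0 ?sqr_ge0// divr_ge0// exprn_ge0// enorm_ge0.
Qed.

(** The automorphic dilations of N; in the product of S, the height a acts on N by [dil] of its
    square root. *)
Definition dil (s : R) (x : N) : N := (s *: x.1, s ^+ 2 *: x.2).

Lemma Nnorm_dil s (x : N) : 0 <= s -> Nnorm (dil s x) = s * Nnorm x.
Proof.
move=> s0; apply/eqP; rewrite -(@eqrXn2 _ 4)// ?Nnorm_ge0 ?mulr_ge0 ?Nnorm_ge0//.
rewrite exprMn !Nnorm_exp4 !enormZ !ger0_norm ?exprn_ge0//; by apply/eqP; field.
Qed.

Lemma Nnorm_inv (x : N) : Nnorm (Ninv x) = Nnorm x.
Proof. by rewrite /Nnorm /= !enormN. Qed.

(** The vector [emb] (X, Z) = (|X|^2 / 4, Z) has Euclidean norm N(X, Z)^2, and [emb] of a product is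
    the sum of the two vectors plus w / 2, where w = (<X, Y>, [X, Y]). By [brv_Bessel], |w| <= |X|
    |Y| <= 4 N(x) N(y), so the square of the left side is at most (N(x) + N(y))^2. *)
Lemma Nnorm_mul x y : Nnorm (Nmul x y) <= Nnorm x + Nnorm y.
Proof.
pose emb (t : N) : 'rV[R]_(1 + dz) := row_mx (dotv t.1 t.1 / 4)%:M t.2.
have embE t : enorm (emb t) = Nnorm t ^+ 2.
  apply/eqP; rewrite -(@eqrXn2 _ 2)// ?enorm_ge0 ?sqr_ge0//.
  rewrite sqr_enorm -exprM Nnorm_exp4 dotv_row_mx dotv_scalar sqr_enorm.
  by rewrite -[4%N]/(2 * 2)%N exprM sqr_enorm; by apply/eqP; field.
pose w : 'rV[R]_(1 + dz) := row_mx (dotv x.1 y.1)%:M (brv x.1 y.1).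
have mulE : emb (Nmul x y) = emb x + emb y + 2^-1 *: w.
  rewrite /emb /w scale_row_mx !add_row_mx scale_scalar_mx -!raddfD.
  congr row_mx; congr _%:M; rewrite /= dotvDl !dotvDr (dotvC y.1 x.1).
  by field.
have half (t : N) : enorm t.1 <= 2 * Nnorm t.
  rewrite -(@ler_pXn2r _ 4)// ?nnegrE ?mulr_ge0 ?enorm_ge0 ?Nnorm_ge0//.
  by rewrite exprMn Nnorm_exp4; have := sqr_ge0 (enorm t.2); lra.
have wE : enorm w <= enorm x.1 * enorm y.1.
  rewrite -(@ler_pXn2r _ 2)// ?nnegrE ?mulr_ge0 ?enorm_ge0//.
  by rewrite exprMn !sqr_enorm dotv_row_mx dotv_scalar -expr2 brv_Bessel.
have wN : enorm w <= 2 * Nnorm x * (2 * Nnorm y).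
  by apply: le_trans wE _; rewrite ler_pM ?enorm_ge0.
rewrite -(@ler_pXn2r _ 2)// ?nnegrE ?addr_ge0 ?Nnorm_ge0//.
rewrite -embE mulE; apply: le_trans (enormD _ _) _.
apply: le_trans (lerD (enormD _ _) (lexx _)) _.
rewrite enormZ !embE ger0_norm ?invr_ge0//; lra.
Qed.

Lemma NballE r x : Nball br Nid r x = (Nnorm x < r).
Proof.
have xE : Nmul (Ninv Nid) x = x.
  by case: x => X W; rewrite /Defs.Nmul/= !oppr0 !add0r brv0l scaler0 addr0.
by rewrite /Nball /= /Ndist xE.
Qed.

Lemma Sset_mul x y : Sset x -> Sset y -> Sset (Smul x y).
Proof. exact: mulr_gt0. Qed.

Lemma Sset_inv (x : G) : Sset x -> Sset (Sinv x).
Proof. by move=> x0; rewrite /Sset /= invr_gt0. Qed.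

Lemma Sset_id : Sset (Sid : G).
Proof. exact: ltr01. Qed.

Lemma Smul_assoc x y z : Sset x -> Sset y ->
  Smul x (Smul y z) = Smul (Smul x y) z.
Proof.
case: x y z => [[X W] a] [[X' W'] a'] [[X'' W''] a''].
rewrite /Sset /= => a0 a0'; rewrite /Defs.Smul /=; congr (_, _);
  last by rewrite mulrA.
have saa : Num.sqrt a * Num.sqrt a = a by rewrite -expr2 sqr_sqrtr// ltW.
have sM : Num.sqrt (a * a') = Num.sqrt a * Num.sqrt a' by rewrite sqrtrM// ltW.
congr (_, _); first by rewrite scalerDr scalerA sM addrA.
rewrite !brvE sM; apply/rowP => i; rewrite !mxE.
by move: (Num.sqrt a) saa => sa saa; rewrite -saa; ring.
Qed.

Lemma Smul1 x : Smul x Sid = x.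
Proof.
case: x => [[X W] a]; rewrite /Defs.Smul /= mulr1; congr (_, _, _).
  by rewrite scaler0 addr0.
by rewrite brv0r !scaler0 !addr0.
Qed.

Lemma Smul_1 x : Smul Sid x = x.
Proof.
case: x => [[X W] a]; rewrite /Defs.Smul /= mul1r sqrtr1; congr (_, _, _).
  by rewrite scale1r add0r.
by rewrite brv0l scale1r add0r scaler0 addr0.
Qed.

Lemma sqrtrV (a : R) : 0 < a -> Num.sqrt a^-1 = (Num.sqrt a)^-1.
Proof.
move=> a0; apply/eqP; rewrite -(@eqrXn2 _ 2)// ?invr_ge0 ?sqrtr_ge0//.
by rewrite exprVn !sqr_sqrtr ?invr_ge0 ?ltW.
Qed.

(** The shape that [rho_dilation] expects: each component is scaled and then shifted, with a shift
    of Z that depends on X. *)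
Lemma Smul_invE x y : Sset x -> Smul (Sinv x) y =
  (((Num.sqrt x.2)^-1 *: y.1.1 + (- ((Num.sqrt x.2)^-1 *: x.1.1)),
    x.2^-1 *: y.1.2 + (- (x.2^-1 *: (x.1.2 + 2^-1 *: brv x.1.1 y.1.1)))),
   x.2^-1 * y.2).
Proof.
case: x y => [[X W] a] [[X' W'] a']; rewrite /Sset /= => a0.
have saa : (Num.sqrt a)^-1 * (Num.sqrt a)^-1 = a^-1.
  by rewrite -invfM -expr2 sqr_sqrtr// ltW.
rewrite /Defs.Smul /= sqrtrV//; congr (_, _, _); first by rewrite addrC.
rewrite !brvE; apply/rowP => i; rewrite !mxE -saa.
by move: (Num.sqrt a)^-1 => sa; ring.
Qed.

Lemma Smul_Vx x : Sset x -> Smul (Sinv x) x = Sid.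
Proof.
move=> x0; rewrite Smul_invE// brvv scaler0 addr0 !subrr mulVf//.
by rewrite gt_eqF.
Qed.

Lemma Sinv_inv (x : G) : Sset x -> Sinv (Sinv x) = x.
Proof.
case: x => [[X W] a]; rewrite /Sset /Sinv /= => a0.
rewrite sqrtrV// !invrK; congr (_, _, _).
  by rewrite scalerN opprK scalerA mulfV ?scale1r// gt_eqF ?sqrtr_gt0.
by rewrite scalerN opprK scalerA mulfV ?scale1r// gt_eqF.
Qed.

Lemma Smul_xV x : Sset x -> Smul x (Sinv x) = Sid.
Proof. by move=> x0; rewrite -{1}(Sinv_inv x0) Smul_Vx//; exact: Sset_inv. Qed.

Lemma SmulK x y : Sset x -> Smul (Sinv x) (Smul x y) = y.
Proof.
by move=> x0; rewrite Smul_assoc ?Smul_Vx ?Smul_1//; exact: Sset_inv.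
Qed.

Lemma SmulVK x y : Sset x -> Smul x (Smul (Sinv x) y) = y.
Proof.
by move=> x0; rewrite Smul_assoc ?Smul_xV ?Smul_1//; exact: Sset_inv.
Qed.

Lemma ltransE x A y : Sset x -> ltrans br x A y = A (Smul (Sinv x) y).
Proof.
move=> x0; apply/propext; split => [[z Az <-]|Az]; first by rewrite SmulK.
by exists (Smul (Sinv x) y) => //; rewrite SmulVK.
Qed.

(** S is the semidirect product of N with the positive reals acting by dilations. In this form the
    N-component of a product in S can be estimated by [Nnorm_mul] and [Nnorm_dil]. *)
Lemma Smul_div1 x y z : Sset x -> Sset y ->
  (Smul x (Smul (Sinv y) z)).1 =
  Nmul x.1 (dil (Num.sqrt (x.2 / y.2)) (Nmul (Ninv y.1) z.1)).
Proof.
case: x y z => [[X W] a] [[X' W'] a'] [[X'' W''] a''] a0 a0'.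
rewrite Smul_invE//; rewrite /Sset /= in a0 a0'.
rewrite /Defs.Smul /Defs.Nmul /dil /= sqr_sqrtr ?divr_ge0 ?ltW//.
rewrite sqrtrM ?ltW// sqrtrV//; congr (_, _).
  by rewrite -scalerN -scalerDr scalerA addrC [X in _ = _ + _ *: X]addrC addrC.
rewrite !brvE; apply/rowP => i; rewrite !mxE.
ring.
Qed.

Lemma powR_Qdim (a : R) : 0 < a ->
  a `^ Qdim R dv dz = Num.sqrt a ^+ dv * a ^+ dz.
Proof.
move=> a0; rewrite -!powR_mulrn ?sqrtr_ge0 ?ltW//.
rewrite -powR12_sqrt ?ltW// -powRrM -powRD; last by rewrite (gt_eqF a0) implybT.
by congr (_ `^ _); rewrite /Qdim natrD natrM; field.
Qed.

Lemma rho_ltrans x A : Sset x ->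
  rho (ltrans br x A) = ((x.2 `^ Qdim R dv dz)%:E * rho A)%E.
Proof.
move=> x0; have s0 : 0 < Num.sqrt x.2 by rewrite sqrtr_gt0.
have -> : ltrans br x A = [set y | A
  (((Num.sqrt x.2)^-1 *: y.1.1 + (- ((Num.sqrt x.2)^-1 *: x.1.1)),
    x.2^-1 *: y.1.2 + (- (x.2^-1 *: (x.1.2 + 2^-1 *: brv x.1.1 y.1.1)))),
   x.2^-1 * y.2)].
  by apply/seteqP; split => y; rewrite ltransE//= Smul_invE.
rewrite (@rho_dilation _ _ _ _ _ _ _
  (fun Y => - (x.2^-1 *: (x.1.2 + 2^-1 *: brv x.1.1 Y)))) ?invr_gt0//.
by rewrite powR_Qdim// !exprVn !invrK.
Qed.

End Htype_group.

(** * Continuity of the group operations, and the differential of a left translation *)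

Section convergence.
Context {R : realType} {dv dz : nat}.
Local Notation V := 'rV[R]_dv.
Local Notation Z := 'rV[R]_dz.
Local Notation N := (V * Z)%type.
Local Notation G := (N * R)%type.

Lemma cvg_sumr (W : normedModType R) (T : Type) (F : set_system T)
    (FF : Filter F) n (f : 'I_n -> T -> W) (u : 'I_n -> W) :
  (forall i, f i @ F --> u i) -> \sum_(i < n) f i x @[x --> F] --> \sum_(i < n) u i.
Proof. by move=> fu; apply: cvg_big => //; exact: add_continuous. Qed.

Lemma cvg_coord (T : Type) (F : set_system T) (FF : Filter F) n
    (f : T -> 'rV[R]_n) (u : 'rV[R]_n) i :
  f @ F --> u -> f x 0 i @[x --> F] --> u 0 i.
Proof.
by move=> fu; exact: (cvg_comp f (fun M : 'rV[R]_n => M 0 i) fu (@coord_continuous _ _ _ _ _ u)).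
Qed.

Lemma cvg_dotv (T : Type) (F : set_system T) (FF : Filter F) n
    (f g : T -> 'rV[R]_n) (u v : 'rV[R]_n) :
  f @ F --> u -> g @ F --> v -> dotv (f x) (g x) @[x --> F] --> dotv u v.
Proof. by move=> fu gv; apply: cvg_sumr => i; apply: cvgM; exact: cvg_coord. Qed.

Lemma cvg_enorm (T : Type) (F : set_system T) (FF : Filter F) n
    (f : T -> 'rV[R]_n) (u : 'rV[R]_n) :
  f @ F --> u -> enorm (f x) @[x --> F] --> enorm u.
Proof.
move=> fu; apply: (cvg_comp (fun x => dotv (f x) (f x)) Num.sqrt).
  by apply: cvg_dotv; exact: fu.
exact: sqrt_continuous.
Qed.

Lemma cvg_proj1 (U W : topologicalType) (T : Type) (F : set_system T)
    (FF : Filter F) (f : T -> U * W) (p : U * W) :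
  f @ F --> p -> (f x).1 @[x --> F] --> p.1.
Proof. by case: p => a b fu; exact: (cvg_comp f fst fu cvg_fst). Qed.

Lemma cvg_proj2 (U W : topologicalType) (T : Type) (F : set_system T)
    (FF : Filter F) (f : T -> U * W) (p : U * W) :
  f @ F --> p -> (f x).2 @[x --> F] --> p.2.
Proof. by case: p => a b fu; exact: (cvg_comp f snd fu cvg_snd). Qed.

Lemma cvg_prod (U W : topologicalType) (T : Type) (F : set_system T)
    (FF : Filter F) (f : T -> U) (g : T -> W) (a : U) (b : W) :
  f @ F --> a -> g @ F --> b -> (f x, g x) @[x --> F] --> (a, b).
Proof. by move=> fa gb; exact: cvg_pair. Qed.

Lemma is_derive_linear (U W : normedModType R) (f : U -> W) (c : R -> U)
    (t : R) (dc : U) :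
  linear f -> continuous f -> is_derive t 1 c dc ->
  is_derive t 1 (f \o c) (f dc).
Proof.
move=> lf cf [dct <-].
pose L : {linear U -> W} := HB.pack f (GRing.isLinear.Build R U W *:%R f lf).
have fB u v : f (u - v) = f u - f v := linearB L u v.
have fZ k u : f (k *: u) = k *: f u := linearZ_LR L k u.
have E : (fun h => h^-1 *: ((f \o c \o shift t) (h *: 1) - (f \o c) t)) =
    f \o (fun h => h^-1 *: ((c \o shift t) (h *: 1) - c t)).
  by apply/funext => h /=; rewrite fZ fB.
have D : h^-1 *: ((f \o c \o shift t) (h *: 1) - (f \o c) t) @[h --> 0^'] -->
    f ('D_1 c t).
  by rewrite E; apply: continuous_cvg; [exact: cf | exact: dct].
have dv' : derivable (f \o c) t 1 by apply/cvg_ex; exists (f ('D_1 c t)); exact: D.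
by apply: DeriveDef dv' _; apply: (cvg_lim _ D); exact: norm_hausdorff.
Qed.

Variable br : N -> N -> N.
Hypothesis hbr : Htype_algebra br.
Local Notation brv := (brv br).
Local Notation Smul := (Smul br).

(** The bracket is bilinear in an algebraic sense only; its expansion over the coordinate basis
    makes it a polynomial, hence continuous. *)
Lemma brv_sum X Y : brv X Y =
  \sum_(i < dv) \sum_(j < dv) (X 0 i * Y 0 j) *: brv (delta_mx 0 i) (delta_mx 0 j).
Proof.
rewrite {1}(row_sum_delta X).
rewrite (big_morph (brv ^~ Y) (fun X X' => brvDl hbr X X' Y) (brv0l hbr Y)).
apply: eq_bigr => i _; rewrite /= (brvZl hbr) {1}(row_sum_delta Y).
rewrite (big_morph (brv _) (brvDr hbr _) (brv0r hbr _)) scaler_sumr.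
by apply: eq_bigr => j _; rewrite (brvZr hbr) scalerA.
Qed.

Lemma cvg_brv (T : Type) (F : set_system T) (FF : Filter F) (f g : T -> V) (u v : V) :
  f @ F --> u -> g @ F --> v -> brv (f x) (g x) @[x --> F] --> brv u v.
Proof.
move=> fu gv; rewrite brv_sum; under eq_cvg do rewrite brv_sum.
apply: cvg_sumr => i; apply: cvg_sumr => j; apply: cvgZr_tmp.
by apply: cvgM; exact: cvg_coord.
Qed.

Lemma cvg_Smul (T : Type) (F : set_system T) (FF : Filter F) (f g : T -> G) (x y : G) :
  f @ F --> x -> g @ F --> y -> Smul (f t) (g t) @[t --> F] --> Smul x y.
Proof.
move=> fx gy; have [fx1 gy1] := (cvg_proj1 FF fx, cvg_proj1 FF gy).
have [fx2 gy2] := (cvg_proj2 FF fx, cvg_proj2 FF gy).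
have sfx2 : Num.sqrt (f t).2 @[t --> F] --> Num.sqrt x.2.
  exact: (cvg_comp (fun t => (f t).2) Num.sqrt fx2 (@sqrt_continuous R _)).
apply: cvg_prod; last exact: cvgM.
apply: cvg_prod.
  by apply: cvgD; [exact: cvg_proj1 | apply: cvgZ => //; exact: cvg_proj1].
apply: cvgD; last first.
  apply: cvgZ; first by apply: cvgM => //; exact: cvg_cst.
  exact: (cvg_brv FF (cvg_proj1 FF fx1) (cvg_proj1 FF gy1)).
by apply: cvgD; [exact: cvg_proj2 | apply: cvgZ => //; exact: cvg_proj2].
Qed.

(* The differential at x of the left translation by x^-1. *)
Definition dltrans_inv (x w : G) : G :=
  (((Num.sqrt x.2)^-1 *: w.1.1,
    x.2^-1 *: (w.1.2 - 2^-1 *: brv x.1.1 w.1.1)), x.2^-1 * w.2).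

Lemma dltrans_inv_linear x : linear (dltrans_inv x).
Proof.
move=> k u v; rewrite /dltrans_inv; congr (_, _, _) => /=.
- by rewrite scalerDr !scalerA mulrC.
- by rewrite !(brvE hbr); apply/rowP => i; rewrite !mxE; ring.
- by rewrite mulrDr mulrCA.
Qed.

Lemma dltrans_invN x w : dltrans_inv x (- w) = - dltrans_inv x w.
Proof.
case: x w => [[X W] a] [[A B] b]; rewrite /dltrans_inv /=.
congr (_, _, _); rewrite /= ?mulrN// ?scalerN//.
by rewrite (brvNr hbr) scalerN; apply/rowP => i; rewrite !mxE; ring.
Qed.

(** Left translations are affine maps of the half-space, so a translated curve is differentiated by
    applying the linear part to the velocity. The constant has height 0 because the height is
    translated linearly. *)
Lemma Smul_inv_dltrans x y : Sset x ->
  Smul (Sinv x) y = dltrans_inv x y - dltrans_inv x (x.1, 0).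
Proof.
move=> x0; rewrite (Smul_invE hbr)// /dltrans_inv; congr (_, _, _) => /=.
  by rewrite (brvv hbr) scaler0 subr0; apply/rowP => i; rewrite !mxE; ring.
by rewrite mulr0 subr0.
Qed.

Lemma cvg_dltrans_inv (T : Type) (F : set_system T) (FF : Filter F)
    (f g : T -> G) (x w : G) : Sset x ->
  f @ F --> x -> g @ F --> w ->
  dltrans_inv (f t) (g t) @[t --> F] --> dltrans_inv x w.
Proof.
move=> x0 fx gw; have [fx1 gw1] := (cvg_proj1 FF fx, cvg_proj1 FF gw).
have [fx2 gw2] := (cvg_proj2 FF fx, cvg_proj2 FF gw).
have sfx2 : Num.sqrt (f t).2 @[t --> F] --> Num.sqrt x.2.
  exact: (cvg_comp (fun t => (f t).2) Num.sqrt fx2 (@sqrt_continuous R _)).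
have ifx2 : (f t).2^-1 @[t --> F] --> x.2^-1.
  by apply: cvgV => //; rewrite gt_eqF.
apply: cvg_prod; last exact: cvgM.
apply: cvg_prod.
  apply: cvgZ; last exact: cvg_proj1.
  by apply: cvgV => //; rewrite gt_eqF// sqrtr_gt0.
apply: cvgZ => //; apply: cvgB; first exact: cvg_proj2.
by apply: cvgZl_tmp; exact: (cvg_brv FF (cvg_proj1 FF fx1) (cvg_proj1 FF gw1)).
Qed.

Lemma cvg_tangent_norm (T : Type) (F : set_system T) (FF : Filter F)
    (f : T -> G) (w : G) : f @ F --> w -> tangent_norm (f t) @[t --> F] --> tangent_norm w.
Proof.
move=> fw; have fw1 := cvg_proj1 FF fw.
pose q (u : G) := dotv u.1.1 u.1.1 + dotv u.1.2 u.1.2 + u.2 * u.2.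
have qE u : tangent_norm u = Num.sqrt (q u) by rewrite /tangent_norm expr2.
rewrite qE; under eq_cvg do rewrite qE.
apply: (cvg_comp (fun t => q (f t)) Num.sqrt); last exact: sqrt_continuous.
apply: cvgD; last by apply: cvgM; exact: cvg_proj2.
have [fw11 fw12] := (cvg_proj1 FF fw1, cvg_proj2 FF fw1).
exact: cvgD (cvg_dotv FF fw11 fw11) (cvg_dotv FF fw12 fw12).
Qed.

End convergence.

(** * Speed and length of curves *)

Lemma is_derive_onem_comp (R : realType) (W : normedModType R) (c : R -> W)
    (t : R) (dc : W) :
  is_derive (1 - t) 1 c dc -> is_derive t 1 (fun s => c (1 - s)) (- dc).
Proof.
case=> dct <-.
have d1 : differentiable (fun s : R => 1 - s) t by [].
have d2 : differentiable c (1 - t) by apply/derivable1_diffP.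
have d12 : differentiable (c \o (fun s : R => 1 - s)) t by exact: differentiable_comp.
apply: DeriveDef; first exact/derivable1_diffP.
rewrite (deriveE _ d12) (diff_comp d1 d2) /= -(deriveE _ d1).
rewrite deriveB// derive_cst derive_id sub0r linearN.
by rewrite -(deriveE _ d2).
Qed.

Section curves.
Context {R : realType} {dv dz : nat}.
Local Notation V := 'rV[R]_dv.
Local Notation Z := 'rV[R]_dz.
Local Notation N := (V * Z)%type.
Local Notation G := (N * R)%type.
Local Notation mu := (@lebesgue_measure R).

Variable br : N -> N -> N.
Hypothesis hbr : Htype_algebra br.
Local Notation Smul := (Smul br).
Local Notation dltrans_inv := (dltrans_inv br).

Lemma tangent_norm_ge0 (w : G) : 0 <= tangent_norm w.
Proof. exact: sqrtr_ge0. Qed.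

Lemma sqr_tangent_norm (w : G) :
  tangent_norm w ^+ 2 = enorm w.1.1 ^+ 2 + enorm w.1.2 ^+ 2 + w.2 ^+ 2.
Proof. by rewrite !sqr_enorm sqr_sqrtr// !addr_ge0 ?dotv_ge0 ?sqr_ge0. Qed.

Lemma tangent_normN (w : G) : tangent_norm (- w) = tangent_norm w.
Proof.
apply/eqP; rewrite -(@eqrXn2 _ 2)// ?tangent_norm_ge0// !sqr_tangent_norm /=.
by rewrite !enormN sqrrN.
Qed.

Lemma le_tangent_norm (w : G) :
  tangent_norm w <= enorm w.1.1 + enorm w.1.2 + `|w.2|.
Proof.
have [[h1 h2] h3] := (enorm_ge0 w.1.1, enorm_ge0 w.1.2, normr_ge0 w.2).
rewrite -(@ler_pXn2r _ 2)// ?nnegrE ?tangent_norm_ge0 ?(addr_ge0 (addr_ge0 h1 h2) h3)//.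
rewrite sqr_tangent_norm -[w.2 ^+ 2]real_normK ?num_real//.
have := mulr_ge0 h2 h3; have := mulr_ge0 h1 h3; have := mulr_ge0 h1 h2.
move: (enorm w.1.1) (enorm w.1.2) `|w.2| {h1 h2 h3} => a b c ab ac bc.
nra.
Qed.

Lemma enorm1_le_tangent_norm (w : G) : enorm w.1.1 <= tangent_norm w.
Proof.
rewrite -(@ler_pXn2r _ 2)// ?nnegrE ?enorm_ge0 ?tangent_norm_ge0//.
by rewrite sqr_tangent_norm -addrA lerDl addr_ge0 ?sqr_ge0.
Qed.

Lemma enorm2_le_tangent_norm (w : G) : enorm w.1.2 <= tangent_norm w.
Proof.
rewrite -(@ler_pXn2r _ 2)// ?nnegrE ?enorm_ge0 ?tangent_norm_ge0//.
by rewrite sqr_tangent_norm addrAC lerDr addr_ge0 ?sqr_ge0.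
Qed.

Lemma norm3_le_tangent_norm (w : G) : `|w.2| <= tangent_norm w.
Proof.
rewrite -(@ler_pXn2r _ 2)// ?nnegrE ?tangent_norm_ge0//.
by rewrite sqr_tangent_norm real_normK ?num_real// lerDr addr_ge0 ?sqr_ge0.
Qed.

Lemma Smul_inv_mul (x y z : G) : Sset x -> Sset y ->
  Smul (Sinv (Smul x y)) (Smul x z) = Smul (Sinv y) z.
Proof.
move=> x0 y0; rewrite -{1}(SmulVK hbr z y0) (Smul_assoc hbr _ x0 y0) (SmulK hbr)//.
exact: (Sset_mul br x0 y0).
Qed.

Lemma continuous_dltrans_inv (x : G) : Sset x -> continuous (dltrans_inv x).
Proof. by move=> x0 w; apply: (cvg_dltrans_inv hbr) => //; exact: cvg_cst. Qed.

Lemma derive1_Smul_inv (x : G) (c : R -> G) t : Sset x -> derivable c t 1 ->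
  derivable (fun s => Smul (Sinv x) (c s)) t 1 /\
  derive1 (fun s => Smul (Sinv x) (c s)) t = dltrans_inv x (derive1 c t).
Proof.
move=> x0 dc.
have -> : (fun s => Smul (Sinv x) (c s)) =
    (dltrans_inv x \o c) - cst (dltrans_inv x (x.1, 0)).
  by apply/funext => s; rewrite (Smul_inv_dltrans hbr).
have H : is_derive t 1 (dltrans_inv x \o c) (dltrans_inv x (derive1 c t)).
  apply: is_derive_linear;
    [exact: dltrans_inv_linear|exact: continuous_dltrans_inv|].
  by rewrite derive1E; exact: derivableP.
have H0 := is_deriveB H (@is_derive_cst _ _ _ (dltrans_inv x (x.1, 0)) t 1).
split; first exact: ex_derive.
by rewrite derive1E derive_val subr0.
Qed.

Section curve.
Variable c : R -> G.
Hypothesis hc : C1_curve c.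

Let cS t : 0 <= t <= 1 -> Sset (c t). Proof. by case: hc => h _ _; exact: h. Qed.
Let cd t : derivable c t 1. Proof. by case: hc => _ h _; exact: h. Qed.
Let cC : continuous (derive1 c). Proof. by case: hc. Qed.

(** A closed form of the speed whose continuity can be checked. Both its continuity and its equality
    with [speed] are claimed on [0, 1], where the curve is known to stay in S. *)
Let sigma t := tangent_norm (dltrans_inv (c t) (derive1 c t)).

Lemma speedE t : 0 <= t <= 1 ->
  speed br c t = tangent_norm (dltrans_inv (c t) (derive1 c t)).
Proof. by move=> t01; rewrite /speed (derive1_Smul_inv (cS t01) (@cd t)).2. Qed.

Let continuous_sigma t : 0 <= t <= 1 -> {for t, continuous sigma}.
Proof.
move=> t01; apply: cvg_tangent_norm; apply: (cvg_dltrans_inv hbr); first exact: cS.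
  by apply: differentiable_continuous; apply/derivable1_diffP.
exact: cC.
Qed.

Let within_sigma : {within `[0, 1], continuous sigma}.
Proof.
apply: continuous_in_subspaceT => t; rewrite inE/= in_itv/=.
exact: continuous_sigma.
Qed.

Let integrable_sigma : mu.-integrable `[0, 1] (EFin \o sigma).
Proof. by apply: continuous_compact_integrable; first exact: segment_compact. Qed.

Let curve_lengthE : curve_length br c = \int[mu]_(t in `[0, 1]) sigma t.
Proof.
by apply: eq_Rintegral => t; rewrite inE/= in_itv/= => /speedE.
Qed.

Lemma curve_length_ge0 : 0 <= curve_length br c.
Proof. by apply: Rintegral_ge0 => t _; exact: tangent_norm_ge0. Qed.

Lemma curve_length_le (M : R) : (forall t, 0 <= t <= 1 -> speed br c t <= M) ->
  curve_length br c <= M.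
Proof.
move=> hM; rewrite curve_lengthE.
apply: (@le_trans _ _ (\int[mu]_(t in `[0, 1]) M)).
  apply: le_Rintegral => //.
    apply: continuous_compact_integrable; first exact: segment_compact.
    by apply: continuous_in_subspaceT => t _; exact: cvg_cst.
  by move=> t; rewrite /= in_itv/= => t01; rewrite /sigma -speedE// hM.
rewrite Rintegral_cst//= lebesgue_measure_itv/= lte_fin ltr01 sube0.
by rewrite mulr1.
Qed.

(** As [dphi] is not assumed continuous, it is not integrated. With F the arc length, K F - phi is
    continuous on [0, 1] and has a nonnegative derivative inside, so it is nondecreasing. *)
Lemma curve_increment_le (phi dphi : R -> R) (K : R) :
  (forall t : R, 0 <= t <= 1 -> is_derive t 1 phi (dphi t)) ->
  (forall t, 0 <= t <= 1 -> dphi t <= K * speed br c t) ->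
  phi 1 - phi 0 <= K * curve_length br c.
Proof.
move=> dphiE dphi_le; pose F x := \int[mu]_(t in `[0, x]) sigma t.
pose h x := K * F x - phi x.
have dF (x : R) : 0 < x < 1 -> is_derive x 1 F (sigma x).
  move=> /andP[x0 x1]; have x01 : 0 <= x <= 1 by rewrite !ltW.
  have [dF <-] := continuous_FTC1_closed x1 integrable_sigma x0 (continuous_sigma x01).
  by rewrite derive1E; exact: derivableP.
have dh (x : R) : 0 < x < 1 -> is_derive x 1 h (K * sigma x - dphi x).
  move=> x01; have x01' : 0 <= x <= 1 by case/andP: x01 => ? ?; rewrite !ltW.
  exact: is_deriveB (is_deriveZ K (dF x x01)) (dphiE x x01').
have ch : {within `[0, 1], continuous h}.
  move=> x; apply: cvgB.
    apply: cvgM; first exact: cvg_cst.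
    exact: (parameterized_integral_continuous ler01 integrable_sigma).
  move: x; apply: continuous_in_subspaceT => x; rewrite inE/= in_itv/= => x01.
  by apply: differentiable_continuous; apply/derivable1_diffP;
    have [] := dphiE x x01.
have hle : h 0 <= h 1.
  have in0 : 0 \in `[0 : R, 1] by rewrite in_itv/= lexx ler01.
  have in1 : 1 \in `[0 : R, 1] by rewrite in_itv/= lexx ler01.
  apply: (ger0_derive1_le_cc _ _ ch in0 in1 ler01).
    by move=> x; rewrite in_itv/= => x01; have [] := dh x x01.
  move=> x; rewrite in_itv/= => x01; rewrite derive1E; have [_ ->] := dh x x01.
  have x01' : 0 <= x <= 1 by case/andP: x01 => ? ?; rewrite !ltW.
  by rewrite subr_ge0 /sigma -speedE// dphi_le.
have F0 : F 0 = 0 by rewrite /F set_itv1 Rintegral_set1.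
rewrite curve_lengthE -/(F 1); move: hle; rewrite /h F0; lra.
Qed.

Lemma C1_curve_rev : C1_curve (fun t => c (1 - t)) /\
  curve_length br (fun t => c (1 - t)) = curve_length br c.
Proof.
have dr (t : R) : is_derive t 1 (fun s => c (1 - s)) (- derive1 c (1 - t)).
  by apply: is_derive_onem_comp; rewrite derive1E; exact: derivableP.
have drE t : derive1 (fun s => c (1 - s)) t = - derive1 c (1 - t).
  by rewrite derive1E; have [_ ->] := dr t.
have flip (t : R) : 0 <= t <= 1 -> 0 <= 1 - t <= 1 by move=> ?; lra.
have C1 : C1_curve (fun t => c (1 - t)).
  split=> [t /flip/cS//|t|]; first by have [] := dr t.
  rewrite (_ : derive1 _ = fun t => - derive1 c (1 - t)); last exact/funext.
  move=> t; apply: cvgN;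
    apply: (@cvg_comp _ _ _ (fun s : R => 1 - s) (derive1 c)); last exact: cC.
  by apply: cvgB; [exact: cvg_cst | exact: cvg_id].
split; first exact: C1.
rewrite curve_lengthE (Rintegration_by_substitution_onem _ within_sigma);
  last first.
  by rewrite ler01 lexx.
rewrite /unstable.onem subrr; apply: eq_Rintegral => t.
rewrite inE/= in_itv/= => t01; rewrite /sigma /speed.
rewrite (derive1_Smul_inv (cS (flip t t01)) _).2; last by have [] := dr t.
by rewrite drE (dltrans_invN hbr) tangent_normN.
Qed.

Lemma C1_curve_ltrans x : Sset x -> C1_curve (fun t => Smul x (c t)) /\
  curve_length br (fun t => Smul x (c t)) = curve_length br c.
Proof.
move=> x0; have xi0 := Sset_inv x0.
(* Translation by x is translation by the inverse of x^-1. *)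
have dx t := derive1_Smul_inv xi0 (@cd t); split.
  split=> [t t01|t|].
  - exact: (Sset_mul br x0 (cS t01)).
  - by have := (dx t).1; rewrite Sinv_inv.
  - have -> : derive1 (fun t => Smul x (c t)) = dltrans_inv (Sinv x) \o derive1 c.
      by apply/funext => t; rewrite /= -(dx t).2 Sinv_inv.
    move=> t; apply: (@cvg_comp _ _ _ (derive1 c) (dltrans_inv (Sinv x)));
      first exact: cC.
    exact: continuous_dltrans_inv.
apply: eq_Rintegral => t; rewrite inE/= in_itv/= => t01; rewrite /speed.
have -> : (fun s => Smul (Sinv (Smul x (c t))) (Smul x (c s))) =
    (fun s => Smul (Sinv (c t)) (c s)); last by [].
by apply/funext => s; rewrite (Smul_inv_mul _ x0 (cS t01)).
Qed.

End curve.

End curves.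

(** * Paths, the Riemannian distance and its balls *)

Section balls.
Context {R : realType} {dv dz : nat}.
Local Notation V := 'rV[R]_dv.
Local Notation Z := 'rV[R]_dz.
Local Notation N := (V * Z)%type.
Local Notation G := (N * R)%type.

Variable br : N -> N -> N.
Hypothesis hbr : Htype_algebra br.
Local Notation brv := (brv br).
Local Notation Smul := (Smul br).
Local Notation dltrans_inv := (dltrans_inv br).
Local Notation path := (piecewise_C1 br).

Lemma piecewise_C1_ge0 x y l : path x y l -> 0 <= l.
Proof.
by elim=> {x y l}[//|c y l hc _ l0]; rewrite addr_ge0// curve_length_ge0.
Qed.

Lemma C1_curve0 (c : R -> G) : C1_curve c -> Sset (c 0).
Proof. by case=> h _ _; apply: h; rewrite lexx ler01. Qed.

Lemma C1_curve1 (c : R -> G) : C1_curve c -> Sset (c 1).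
Proof. by case=> h _ _; apply: h; rewrite lexx ler01. Qed.

Lemma piecewise_C1_Sset x y l : path x y l -> Sset x /\ Sset y.
Proof. by elim=> {x y l}[//|c y l hc _ [_ ?]]; split=> //; exact: C1_curve0. Qed.

Lemma piecewise_C1_curve (c : R -> G) : C1_curve c ->
  path (c 0) (c 1) (curve_length br c).
Proof.
move=> hc; rewrite -[curve_length _ _]addr0; apply: piecewise_cons => //.
by apply: piecewise_nil; exact: C1_curve1.
Qed.

Lemma piecewise_C1_cat x y z l m : path x y l -> path y z m -> path x z (l + m).
Proof.
move=> p; elim: p z m => {x y l}[x _|c y l hc _ IH] z m q; first by rewrite add0r.
by rewrite -addrA; apply: piecewise_cons => //; exact: IH.
Qed.

Lemma piecewise_C1_rev x y l : path x y l -> path y x l.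
Proof.
elim=> {x y l}[x x0|c y l hc _ IH]; first exact: piecewise_nil.
rewrite addrC; apply: (piecewise_C1_cat IH).
have [hr <-] := C1_curve_rev hbr hc.
have := piecewise_C1_curve hr; by rewrite subr0 subrr.
Qed.

Lemma piecewise_C1_ltrans x y z l : Sset x -> path y z l ->
  path (Smul x y) (Smul x z) l.
Proof.
move=> x0; elim=> {y z l}[y y0|c y l hc _ IH].
  by apply: piecewise_nil; exact: (Sset_mul br x0 y0).
have [ht <-] := C1_curve_ltrans hbr hc x0.
exact: (piecewise_cons ht IH).
Qed.

Lemma piecewise_C1_increment (phi : G -> R) (K : R) x y l :
  (forall c, C1_curve c -> phi (c 1) - phi (c 0) <= K * curve_length br c) ->
  path x y l -> phi y - phi x <= K * l.
Proof.
move=> h; elim=> {x y l}[x _|c y l hc _ IH]; first by rewrite subrr mulr0.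
by have := h c hc; rewrite mulrDr; move: IH; lra.
Qed.

(** Straight in the coordinates, not a geodesic. It stays in the convex half-space S, so it joins
    any two points, and its length bounds the distance from above near the identity. *)
Definition segment (x y : G) : R -> G := fun t => x + t *: (y - x).

Lemma segment0 x y : segment x y 0 = x.
Proof. by rewrite /segment scale0r addr0. Qed.

Lemma segment1 x y : segment x y 1 = y.
Proof. by rewrite /segment scale1r addrC subrK. Qed.

Lemma derive1_affine (W : normedModType R) (x w : W) (t : R) :
  is_derive t 1 (fun s : R => x + s *: w) w.
Proof.
have -> : (fun s : R => x + s *: w) = cst x + (fun s : R => s *: w) by [].
have lf : linear (fun s : R => s *: w).
  by move=> k u v; rewrite scalerDl scalerA.
have cf : continuous (fun s : R => s *: w).
  by move=> s; apply: cvgZr_tmp; exact: cvg_id.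
have H := is_derive_linear lf cf (@is_derive_id _ _ t 1).
have := is_deriveD (is_derive_cst x t 1) H.
by rewrite /= scale1r add0r.
Qed.

Lemma C1_curve_segment x y : Sset x -> Sset y -> C1_curve (segment x y).
Proof.
move=> x0 y0; split=> [t /andP[t0 t1]|t|].
- rewrite /Sset /segment /= -[_ *: _]/(t * (y.2 - x.2)).
  have : 0 < y.2 by []. have : 0 < x.2 by [].
  move: x.2 y.2 => {x0 y0} a b a0 b0.
  have -> : a + t * (b - a) = (1 - t) * a + t * b by ring.
  have [->|t_neq] := eqVneq t 0; first by rewrite subr0 mul1r mul0r addr0.
  have tp : 0 < t by rewrite lt_def t_neq.
  have := mulr_gt0 tp b0; have : 0 <= (1 - t) * a by apply: mulr_ge0;
    [rewrite subr_ge0 | exact: ltW].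
  lra.
- by have [] := derive1_affine x (y - x) t.
- have -> : derive1 (segment x y) = cst (y - x).
    by apply/funext => t; rewrite derive1E;
      have [_ ->] := derive1_affine x (y - x) t.
  by move=> t; exact: cvg_cst.
Qed.

Lemma SballP x r y : Sset x ->
  Sball br x r y <-> exists l, path x y l /\ l < r.
Proof.
move=> x0; split=> [[y0 xy]|[l [p lr]]].
  (* The [inf] of the empty set is 0 by default, so a path has to be exhibited. *)
  have ne : [set l | path x y l] !=set0.
    exists (curve_length br (segment x y)) => /=.
    have := piecewise_C1_curve (C1_curve_segment x0 y0).
    by rewrite segment0 segment1.
  by have [l l1 l2] := inf_lt ne xy; exists l.
have [_ y0] := piecewise_C1_Sset p; split=> //.
apply: le_lt_trans lr; apply: ge_inf => //.
by exists 0 => m /= /piecewise_C1_ge0.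
Qed.

Lemma Sball_Sset x r y : Sball br x r y -> Sset y.
Proof. by case. Qed.

Lemma Sball_sym x r y : Sset x -> Sball br x r y -> Sball br y r x.
Proof.
move=> x0 /[dup]/Sball_Sset y0 /(SballP _ _ x0)[l [p lr]].
by apply/SballP => //; exists l; split=> //; exact: piecewise_C1_rev.
Qed.

Lemma Sball_trans x r y s z : Sset x ->
  Sball br x r y -> Sball br y s z -> Sball br x (r + s) z.
Proof.
move=> x0 /[dup]/Sball_Sset y0 /(SballP _ _ x0)[l [p lr]].
move=> /(SballP _ _ y0)[m [q ms]]; apply/SballP => //.
by exists (l + m); split; [exact: piecewise_C1_cat q | exact: ltrD].
Qed.

Lemma le_Sball x r s : r <= s -> Sball br x r `<=` Sball br x s.
Proof. by move=> rs y [y0 xy]; split=> //; exact: lt_le_trans rs. Qed.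

Lemma Sball_ltrans x r : Sset x -> Sball br x r = ltrans br x (Sball br Sid r).
Proof.
move=> x0; have e0 : Sset (Sid : G) := Sset_id.
apply/seteqP; split=> y.
  move=> /(SballP _ _ x0)[l [p lr]]; rewrite (ltransE hbr)//.
  apply/SballP => //; exists l; split=> //; rewrite -(Smul_Vx hbr x0).
  by apply: piecewise_C1_ltrans => //; exact: Sset_inv.
rewrite (ltransE hbr)// => /(SballP _ _ e0)[l [p lr]].
apply/SballP => //; exists l; split=> //.
have := piecewise_C1_ltrans x0 p; by rewrite (Smul1 hbr) (SmulVK hbr).
Qed.

Lemma speed_segment x y t : Sset x -> Sset y -> 0 <= t <= 1 ->
  speed br (segment x y) t = tangent_norm (dltrans_inv (segment x y t) (y - x)).
Proof.
move=> x0 y0 t01; rewrite (speedE hbr (C1_curve_segment x0 y0) t01).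
by congr (tangent_norm (dltrans_inv _ _)); rewrite derive1E;
  have [_ ->] := derive1_affine x (y - x) t.
Qed.

(** Along the segment the height a is at least 1/2 and the V-component has norm at most 1. Hence
    a^-1 and a^(-1/2) are at most 2, and the bracket term of the velocity is at most |X| / 2: the
    speed is bounded by 2 |X| + 2 (|Z| + |X| / 2) + 2 |a - 1|. *)
Lemma length_segment_id (z : G) : `|z.2 - 1| <= 2^-1 -> enorm z.1.1 <= 1 ->
  curve_length br (segment Sid z) <=
  3 * enorm z.1.1 + 2 * enorm z.1.2 + 2 * `|z.2 - 1|.
Proof.
move=> z2 z11; have z2' : 2^-1 <= z.2 by move: z2; rewrite ler_norml; lra.
have z0 : Sset z by rewrite /Sset /=; lra.
apply: (curve_length_le hbr (C1_curve_segment (@Sset_id R dv dz) z0)) => t t01.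
rewrite speed_segment//; last exact: Sset_id.
apply: le_trans (le_tangent_norm _) _.
set p := segment _ _ _.
have p2 : 2^-1 <= p.2.
  rewrite /p /segment /= -[_ *: _]/(t * (z.2 - 1)).
  by case/andP: t01 => t0 t1; nra.
have p11 : enorm p.1.1 <= 1.
  rewrite /p /segment /= add0r subr0 enormZ.
  have -> : `|t| = t by rewrite ger0_norm//; case/andP: t01.
  case/andP: t01 => t0 t1; have := enorm_ge0 z.1.1; nra.
clearbody p; have pi : p.2^-1 <= 2.
  by rewrite -[leRHS]invrK lef_pV2 ?posrE//; lra.
have pi0 : 0 <= p.2^-1 by rewrite invr_ge0; lra.
have spi0 : 0 <= (Num.sqrt p.2)^-1 by rewrite invr_ge0 sqrtr_ge0.
have spi : (Num.sqrt p.2)^-1 <= 2.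
  rewrite -(@ler_pXn2r _ 2)// ?nnegrE// exprVn sqr_sqrtr; last by lra.
  by apply: le_trans pi _; rewrite expr2; lra.
rewrite /dltrans_inv /= !subr0 !enormZ normrM (ger0_norm pi0) (ger0_norm spi0).
have h2 : enorm (z.1.2 - 2^-1 *: brv p.1.1 z.1.1) <= enorm z.1.2 + 2^-1 * enorm z.1.1.
  apply: le_trans (enormD _ _) _;
    rewrite lerD2l enormN enormZ ger0_norm ?invr_ge0//.
  rewrite ler_pM2l ?invr_gt0//; apply: le_trans (enorm_brv hbr _ _) _.
  by rewrite ler_piMl// enorm_ge0.
have := ler_pM spi0 (enorm_ge0 z.1.1) spi (lexx _).
have := ler_pM pi0 (enorm_ge0 _) pi h2.
have := ler_pM pi0 (normr_ge0 (z.2 - 1)) pi (lexx _).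
lra.
Qed.

Lemma mem_Sball_id r (z : G) : `|z.2 - 1| <= 2^-1 -> enorm z.1.1 <= 1 ->
  3 * enorm z.1.1 + 2 * enorm z.1.2 + 2 * `|z.2 - 1| < r -> Sball br Sid r z.
Proof.
move=> z2 z11 zr; have e0 : Sset (Sid : G) := Sset_id.
have z0 : Sset z by move: z2; rewrite /Sset /= ler_norml; lra.
apply/SballP => //; exists (curve_length br (segment Sid z)); split.
  have := piecewise_C1_curve (C1_curve_segment e0 z0).
  by rewrite segment0 segment1.
by apply: le_lt_trans zr; exact: length_segment_id.
Qed.

Lemma nbhs_Sball_id r : 0 < r -> nbhs (Sid : G) (Sball br Sid r).
Proof.
move=> r0.
pose h (z : G) := 3 * enorm z.1.1 + 2 * enorm z.1.2 + 2 * `|z.2 - 1|.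
have z1 : (fun z : G => z.1) z @[z --> (Sid : G)] --> (Sid : G).1.
  by apply: cvg_proj1; exact: cvg_id.
have z2 : `|z.2 - 1| @[z --> (Sid : G)] --> (0 : R).
  rewrite -(@normr0 _ R) -(subrr (1 : R)).
  apply: cvg_norm; apply: cvgB; last exact: cvg_cst.
  by apply: (@cvg_proj2 _ _ _ _ _ _ (Sid : G)); exact: cvg_id.
have e0 n : enorm (0 : 'rV[R]_n) = 0 by rewrite /enorm dotv0l sqrtr0.
have z11 : enorm z.1.1 @[z --> (Sid : G)] --> (0 : R).
  rewrite -(e0 dv); apply: cvg_enorm; exact: (cvg_proj1 _ z1).
have z12 : enorm z.1.2 @[z --> (Sid : G)] --> (0 : R).
  rewrite -(e0 dz); apply: cvg_enorm; exact: (cvg_proj2 _ z1).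
have ch : h z @[z --> (Sid : G)] --> (0 : R).
  have -> : (0 : R) = 3 * 0 + 2 * 0 + 2 * 0 by rewrite !mulr0 !addr0.
  by do 2?apply: cvgD; apply: cvgM => //; exact: cvg_cst.
near=> z; apply: mem_Sball_id.
- by apply: ltW; near: z; apply: (cvgr_lt 0 z2); rewrite invr_gt0.
- by apply: ltW; near: z; exact: (cvgr_lt 0 z11).
- by near: z; exact: (cvgr_lt 0 ch).
Unshelve. all: by end_near. Qed.

(** By left invariance and the triangle inequality, it is enough that balls at the identity are
    neighbourhoods: as z tends to y, y^-1 z tends to the identity. *)
Lemma open_Sball x r : Sset x -> open (Sball br x r).
Proof.
move=> x0; rewrite openE => y /[dup]/Sball_Sset y0 /(SballP _ _ x0)[l [p lr]].
have rl0 : 0 < r - l by rewrite subr_gt0.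
have cy : Smul (Sinv y) z @[z --> y] --> (Sid : G).
  rewrite -(Smul_Vx hbr y0); apply: (cvg_Smul hbr); first exact: cvg_cst.
  exact: cvg_id.
rewrite /interior; near=> z.
have : Sball br Sid (r - l) (Smul (Sinv y) z).
  by near: z; exact: (cy _ (nbhs_Sball_id rl0)).
rewrite -(ltransE hbr)// -Sball_ltrans// => /(SballP _ _ y0)[m [q mr]].
apply/SballP => //; exists (l + m); split; first exact: piecewise_C1_cat q.
by rewrite addrC -ltrBrDr.
Unshelve. all: by end_near. Qed.

End balls.

(** * Growth of the height and of the gauge along curves *)

Section ball_bounds.
Context {R : realType} {dv dz : nat}.
Local Notation V := 'rV[R]_dv.
Local Notation Z := 'rV[R]_dz.
Local Notation N := (V * Z)%type.
Local Notation G := (N * R)%type.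

Lemma is_derive_fst (U W : normedModType R) (c : R -> U * W) (t : R) (dc : U * W) :
  is_derive t 1 c dc -> is_derive t 1 (fun s => (c s).1) dc.1.
Proof.
have lf : linear (fst : U * W -> U) by [].
by apply: (is_derive_linear lf) => -[a b]; exact: cvg_fst.
Qed.

Lemma is_derive_snd (U W : normedModType R) (c : R -> U * W) (t : R) (dc : U * W) :
  is_derive t 1 c dc -> is_derive t 1 (fun s => (c s).2) dc.2.
Proof.
have lf : linear (snd : U * W -> W) by [].
by apply: (is_derive_linear lf) => -[a b]; exact: cvg_snd.
Qed.

Lemma is_derive_dotv n (f : R -> 'rV[R]_n) (t : R) (df : 'rV[R]_n) : is_derive t 1 f df ->
  is_derive t 1 (fun s => dotv (f s) (f s)) (2 * dotv (f t) df).
Proof.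
move=> hf; have hi i : is_derive t 1 (fun s => f s 0 i) (df 0 i).
  have lf : linear (fun M : 'rV[R]_n => M 0 i) by move=> k u v; rewrite !mxE.
  by apply: (is_derive_linear lf _ hf); exact: coord_continuous.
have -> : (fun s => dotv (f s) (f s)) =
    \sum_(i < n) ((fun s => f s 0 i) * (fun s => f s 0 i)).
  by apply/funext => s; rewrite fct_sumE.
apply: is_derive_eq; rewrite mulr_sumr; apply: eq_bigr => i _.
rewrite -[_ *: _]/(f t 0 i * df 0 i); ring.
Qed.

Variable br : N -> N -> N.
Hypothesis hbr : Htype_algebra br.
Local Notation brv := (brv br).
Local Notation dltrans_inv := (dltrans_inv br).

Section curve.
Variable c : R -> G.
Hypothesis hc : C1_curve c.

Let dc (t : R) : is_derive t 1 c (derive1 c t).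
Proof. by case: hc => _ h _; rewrite derive1E; exact: derivableP. Qed.

Let cS t : 0 <= t <= 1 -> Sset (c t). Proof. by case: hc => h _ _; exact: h. Qed.

Let d2 t := is_derive_snd (dc t).

Let dln (t : R) : 0 <= t <= 1 ->
  is_derive t 1 (fun s => ln (c s).2) ((c t).2^-1 * (derive1 c t).2).
Proof. by move=> t01; exact: (is_derive1_comp (is_derive1_ln (cS t01)) (d2 t)). Qed.

Let dln_le t : 0 <= t <= 1 -> `|(c t).2^-1 * (derive1 c t).2| <= speed br c t.
Proof.
by move=> t01; rewrite (speedE hbr hc t01);
  exact: (norm3_le_tangent_norm (dltrans_inv (c t) (derive1 c t))).
Qed.

Lemma curve_ln_le : `|ln (c 1).2 - ln (c 0).2| <= curve_length br c.
Proof.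
rewrite ler_norml; apply/andP; split.
  rewrite lerNl; have := @curve_increment_le _ _ _ _ hbr _ hc
    (fun s => - ln (c s).2) (fun t => - ((c t).2^-1 * (derive1 c t).2)) 1.
  rewrite mul1r -opprD; apply => t t01; first exact: is_deriveN (dln t01).
  by rewrite mul1r; apply: le_trans (dln_le t01); rewrite -normrN ler_norm.
have := @curve_increment_le _ _ _ _ hbr _ hc (fun s => ln (c s).2)
  (fun t => (c t).2^-1 * (derive1 c t).2) 1.
rewrite mul1r; apply => t t01; first exact: dln.
by rewrite mul1r; apply: le_trans (dln_le t01); exact: ler_norm.
Qed.

End curve.

(** A majorant of [Nnorm] ^+ 4 that is differentiable, being built from products, and positive on S
    thanks to the term a^2. Its three terms have the same degree when X, Z and a scale by s, s^2 and
    s^2, which keeps its logarithmic derivative bounded in the invariant metric. *)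
Definition gauge (x : G) : R :=
  x.2 * x.2 + dotv x.1.1 x.1.1 * dotv x.1.1 x.1.1 + dotv x.1.2 x.1.2.

Lemma gauge_gt0 x : Sset x -> 0 < gauge x.
Proof.
move=> x0; rewrite /gauge -addrA ltr_pwDl ?mulr_gt0// addr_ge0 ?dotv_ge0//.
by rewrite mulr_ge0 ?dotv_ge0.
Qed.

(** A tangent vector w at (X, Z, a) of invariant norm sg satisfies |w_X| <= a^(1/2) sg, |w_Z -
    [X, w_X] / 2| <= a sg and |w_a| <= a sg. These bounds make the derivative of the gauge at most 8
    sg times the gauge. *)
Lemma curve_gauge_le (c : R -> G) : C1_curve c ->
  ln (gauge (c 1)) - ln (gauge (c 0)) <= 8 * curve_length br c.
Proof.
move=> hc; have [cS cd _] := hc; pose c' := derive1 c.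
have dc (t : R) : is_derive t 1 c (c' t) by rewrite /c' derive1E;
  exact/derivableP/cd.
have d1 t := is_derive_fst (dc t); have d2 t := is_derive_snd (dc t).
have d11 t := is_derive_dotv (is_derive_fst (d1 t)).
have d12 t := is_derive_dotv (is_derive_snd (d1 t)).
pose dg t := 2 * ((c t).2 * (c' t).2) +
  4 * dotv (c t).1.1 (c t).1.1 * dotv (c t).1.1 (c' t).1.1 +
  2 * dotv (c t).1.2 (c' t).1.2.
have dgauge (t : R) : is_derive t 1 (fun s => gauge (c s)) (dg t).
  have H := is_deriveD (is_deriveD (is_deriveM (d2 t) (d2 t))
    (is_deriveM (d11 t) (d11 t))) (d12 t).
  apply: (is_derive_eq H); rewrite /dg -![_ *: _]/(_ * _ : R); ring.
have dln (t : R) : 0 <= t <= 1 ->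
    is_derive t 1 (fun s => ln (gauge (c s))) ((gauge (c t))^-1 * dg t).
  move=> t01.
  have L : is_derive (gauge (c t)) 1 (@ln R) (gauge (c t))^-1.
    exact: is_derive1_ln (gauge_gt0 (cS t t01)).
  exact: (@is_derive1_comp R (@ln R) (fun s => gauge (c s)) t _ _ L (dgauge t)).
apply: (curve_increment_le hbr hc dln) => t t01.
have x0 := cS t t01; have g0 := gauge_gt0 x0.
rewrite ler_pdivrMl// (speedE hbr hc t01).
have h1 := enorm1_le_tangent_norm (dltrans_inv (c t) (c' t)).
have h2 := enorm2_le_tangent_norm (dltrans_inv (c t) (c' t)).
have h3 := norm3_le_tangent_norm (dltrans_inv (c t) (c' t)).
rewrite -/c'; move: (tangent_norm _) h1 h2 h3 => sg.
rewrite /dltrans_inv /gauge /dg /=; move: (c' t) (c t) x0 {g0} => w x x0 /=.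
have x20 : 0 < x.2 := x0; have sx : 0 < Num.sqrt x.2 by rewrite sqrtr_gt0.
have xi0 : 0 <= x.2^-1 by rewrite invr_ge0 ltW.
have sxi0 : 0 <= (Num.sqrt x.2)^-1 by rewrite invr_ge0 ltW.
rewrite !enormZ normrM (ger0_norm xi0) (ger0_norm sxi0).
rewrite !ler_pdivrMl// => h1 h2 h3.
have := sqr_sqrtr (ltW x20).
set p := Num.sqrt x.2 in h1 sx * => pE.
set q := enorm x.1.1; set z := enorm x.1.2.
have q0 : 0 <= q := enorm_ge0 _; have z0 : 0 <= z := enorm_ge0 _.
have s0 : 0 <= sg.
  by rewrite -(pmulr_rge0 _ sx); apply: le_trans h1; exact: enorm_ge0.
have b1 : enorm (brv x.1.1 w.1.1) <= q * (p * sg).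
  by apply: le_trans (enorm_brv hbr _ _) _; rewrite ler_wpM2l.
have h2' : enorm w.1.2 <= x.2 * sg + 2^-1 * (q * (p * sg)).
  have -> : w.1.2 = (w.1.2 - 2^-1 *: brv x.1.1 w.1.1) + 2^-1 *: brv x.1.1 w.1.1.
    by rewrite subrK.
  apply: le_trans (enormD _ _) _; rewrite lerD// enormZ ger0_norm ?invr_ge0//.
  by rewrite ler_wpM2l ?invr_ge0.
have k1 : dotv x.1.1 w.1.1 <= q * (p * sg).
  apply: le_trans (ler_norm _) _; apply: le_trans (Cauchy_Schwarz _ _) _.
  by rewrite ler_wpM2l.
have k2 : dotv x.1.2 w.1.2 <= z * (x.2 * sg + 2^-1 * (q * (p * sg))).
  apply: le_trans (ler_norm _) _; apply: le_trans (Cauchy_Schwarz _ _) _.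
  by rewrite ler_wpM2l.
have k3 : x.2 * w.2 <= x.2 * (x.2 * sg).
  by apply: (ler_wpM2l (ltW x20)); apply: le_trans (ler_norm _) h3.
have k1' : q ^+ 2 * dotv x.1.1 w.1.1 <= q ^+ 2 * (q * (p * sg)).
  by rewrite ler_wpM2l ?sqr_ge0.
rewrite -!sqr_enorm -/q -/z.
(* Both sides have degree 4 when q and p = a^(1/2) have weight 1 and z has weight 2. The squares
   [s1] to [s4], with (q p)^2 = q^2 a, absorb the mixed terms; the constant 8 is not sharp. *)
suff H : 2 * (x.2 * x.2) + 4 * q ^+ 2 * (q * p) + 2 * (z * (x.2 + 2^-1 * (q * p))) <=
    8 * (x.2 * x.2 + q ^+ 2 * q ^+ 2 + z ^+ 2).
  have := ler_wpM2r s0 H; move: k1' k2 k3.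
  rewrite !mulrDr !mulrDl; lra.
have s1 := sqr_ge0 (q ^+ 2 - q * p); have s2 := sqr_ge0 (q ^+ 2 - x.2).
have s3 := sqr_ge0 (z - x.2); have s4 := sqr_ge0 (z - q * p).
have E : (q * p) ^+ 2 = q ^+ 2 * x.2 by rewrite exprMn pE.
move: E s1 s2 s3 s4; rewrite !sqrrB !expr2.
move: (q * p) (q * q) (x.2) => T S P; nra.
Qed.

Lemma Sball_ln x r y : Sset x -> Sball br x r y -> `|ln y.2 - ln x.2| < r.
Proof.
move=> x0 /(SballP br _ _ x0)[l [p lr]]; apply: le_lt_trans lr.
rewrite -[l]mul1r ler_norml; apply/andP; split.
  rewrite lerNl opprB -[X in _ <= X]mul1r mul1r.
  apply: (piecewise_C1_increment (phi := fun z => ln z.2) _ (piecewise_C1_rev hbr p)).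
  by move=> c hc; rewrite mul1r; apply: le_trans (curve_ln_le hc); exact: ler_norm.
apply: (piecewise_C1_increment (phi := fun z => ln z.2) _ p).
by move=> c hc; rewrite mul1r; apply: le_trans (curve_ln_le hc); exact: ler_norm.
Qed.

(** The gauge is 1 at the identity, so N^4 <= gauge <= e^(8 l) < (e^(2 r))^4 at the end of a path of
    length l < r. *)
Lemma Sball_id_bounded r : Sball br Sid r `<=`
  Scyl (Nball br Nid (expR (2 * r))) (expR (- r)) (expR r).
Proof.
have e0 := @Sset_id R dv dz.
move=> y /[dup] /[dup]/Sball_Sset y0 /(Sball_ln e0) /= lny.
move=> /(SballP br _ _ e0)[l [p lr]]; rewrite ln1 subr0 ltr_norml in lny.
have yE : y.2 = expR (ln y.2) by rewrite lnK.
split; last by rewrite yE !ltr_expR.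
rewrite NballE// -(@ltr_pXn2r _ 4)// ?nnegrE ?Nnorm_ge0 ?expR_ge0//.
rewrite Nnorm_exp4 -expRM_natl.
have := piecewise_C1_increment (phi := fun z => ln (gauge z)) curve_gauge_le p.
have -> : gauge (Sid : G) = 1 by rewrite /gauge /= !dotv0l mul0r !addr0 mulr1.
rewrite ln1 subr0 => gl.
have : gauge y <= expR (8 * l) by rewrite -(lnK (gauge_gt0 y0)) ler_expR.
move=> /le_lt_trans gy; apply: le_lt_trans (gy (expR (4 * (2 * r))) _).
  rewrite /gauge -!sqr_enorm -exprD -expr2 -[(2 + 2)%N]/4%N.
  have := sqr_ge0 y.2; have := exprn_ge0 4 (enorm_ge0 y.1.1); lra.
rewrite ltr_expR; lra.
Qed.

End ball_bounds.

(** * Open cylinders, and the volume of balls of N *)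

Section volume.
Context {R : realType} {dv dz : nat}.
Local Notation V := 'rV[R]_dv.
Local Notation Z := 'rV[R]_dz.
Local Notation N := (V * Z)%type.
Local Notation G := (N * R)%type.

Lemma interval_ln (a r y : R) : 0 < a -> 0 < r -> 0 < y ->
  (a / r < y < a * r) = (`|ln y - ln a| < ln r).
Proof.
move=> a0 r0 y0; have ar : a / r \is Num.pos by rewrite posrE divr_gt0.
rewrite ltr_distl -[a / r < y](ltr_ln ar) ?posrE// -[y < a * r]ltr_ln ?posrE ?mulr_gt0//.
by rewrite ln_div ?posrE// lnM ?posrE.
Qed.

Lemma interval1_ln (r y : R) : 0 < r -> 0 < y ->
  (r^-1 < y < r) = (`|ln y| < ln r).
Proof.
by move=> r0 y0; have := interval_ln ltr01 r0 y0; rewrite div1r mul1r ln1 subr0.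
Qed.

Lemma open_Scyl (A : set N) (s t : R) : open A -> open (Scyl A s t).
Proof.
move=> oA; rewrite openE => y [Ay /andP[sy yt]].
have y1 : z.1 @[z --> y] --> y.1 by apply: cvg_proj1; exact: cvg_id.
have y2 : z.2 @[z --> y] --> y.2 by apply: cvg_proj2; exact: cvg_id.
rewrite /interior; near=> z; split.
  by near: z; apply: (y1 A); exact: open_nbhs_nbhs.
apply/andP; split; near: z; [exact: (cvgr_gt _ y2) | exact: (cvgr_lt _ y2)].
Unshelve. all: by end_near. Qed.

Lemma Nnorm_lt (x : N) (s : R) : 0 < s ->
  (Nnorm x < s) = (enorm x.1 ^+ 4 / 16 + enorm x.2 ^+ 2 < s ^+ 4).
Proof.
by move=> s0; rewrite -Nnorm_exp4 ltr_pXn2r// ?nnegrE ?Nnorm_ge0 ?ltW.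
Qed.

Variable br : N -> N -> N.
Hypothesis hbr : Htype_algebra br.
Local Notation Smul := (Smul br).

Lemma open_Nball (s : R) : 0 < s -> open (Nball br Nid s).
Proof.
move=> s0; rewrite openE => y; rewrite (NballE hbr) Nnorm_lt// => ys.
have h1 : enorm z.1 @[z --> y] --> enorm y.1.
  by apply: cvg_enorm; apply: cvg_proj1; exact: cvg_id.
have h2 : enorm z.2 @[z --> y] --> enorm y.2.
  by apply: cvg_enorm; apply: cvg_proj2; exact: cvg_id.
have h : enorm z.1 ^+ 4 / 16 + enorm z.2 ^+ 2 @[z --> y] -->
    enorm y.1 ^+ 4 / 16 + enorm y.2 ^+ 2.
  apply: cvgD; last exact: (cvg_comp _ (fun t : R => t ^+ 2) h2 (@exprn_continuous _ _ _)).
  apply: cvgM; last exact: cvg_cst.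
  exact: (cvg_comp _ (fun t : R => t ^+ 4) h1 (@exprn_continuous _ _ _)).
rewrite /interior; near=> z; rewrite /= (NballE hbr) Nnorm_lt//.
by near: z; exact: (cvgr_lt _ h).
Unshelve. all: by end_near. Qed.

Lemma open_ltrans (x : G) (A : set G) : Sset x -> open A -> open (ltrans br x A).
Proof.
move=> x0 oA; rewrite openE => y; rewrite (ltransE hbr)// => Ay.
have h : Smul (Sinv x) z @[z --> y] --> Smul (Sinv x) y.
  by apply: (cvg_Smul hbr); [exact: cvg_cst | exact: cvg_id].
rewrite /interior; near=> z; rewrite /= (ltransE hbr)//.
by near: z; apply: (h A); exact: open_nbhs_nbhs.
Unshelve. all: by end_near. Qed.

Lemma Nhaar_Nball (s : R) : 0 < s ->
  Nhaar (Nball br Nid s) =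
  ((s ^+ (dv + 2 * dz))%:E * Nhaar (Nball br Nid 1))%E.
Proof.
move=> s0; have si0 : 0 < s^-1 by rewrite invr_gt0.
have -> : Nball br Nid s =
    [set y | Nball br Nid 1 (s^-1 *: y.1 + 0, (s^-1) ^+ 2 *: y.2 + 0)].
  apply/seteqP; split=> y /=; rewrite !(NballE hbr) !addr0.
    by rewrite -[(_, _)]/(dil s^-1 y) Nnorm_dil ?ltW// ltr_pdivrMl// mulr1.
  by rewrite -[(_, _)]/(dil s^-1 y) Nnorm_dil ?ltW// ltr_pdivrMl// mulr1.
have -> : s ^+ (dv + 2 * dz) = (s^-1) ^- dv * ((s^-1) ^+ 2) ^- dz.
  by rewrite exprD exprM -!exprVn !invrK.
exact: (@Nhaar_affine R dv dz s^-1 (s^-1 ^+ 2) 0 (fun=> 0) (Nball br Nid 1)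
  si0 (exprn_gt0 2 si0)).
Qed.

(** The Riemannian ball of radius 1/2 lies between two cylinders over dilates of the unit ball of N.
    The inner one has finite measure, so the unit ball does too; the outer one has positive measure,
    so the unit ball is not null. *)
Lemma Nhaar_Nball1 (g1 g2 : R) : 0 < g1 ->
  (g1%:E <= rho (Sball br Sid 2^-1) <= g2%:E)%E ->
  exists2 v : R, 0 < v & Nhaar (Nball br Nid 1) = v%:E.
Proof.
move=> g10 /andP[h1 h2]; set D := (dv + 2 * dz)%N.
(* Small enough that |X| < 2 s, |Z| < s^2 and |a - 1| < s keep the bound 3 |X| + 2 |Z| + 2 |a - 1|
   of [mem_Sball_id] below 1/2. *)
pose s : R := 100^-1; have s0 : 0 < s by rewrite invr_gt0.
have b1 : (rho (Scyl (Nball br Nid s) (1 + s)^-1 (1 + s)) <= g2%:E)%E.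
  apply: le_trans h2; apply: le_rho => z [+ /andP[z1 z2]].
  rewrite (NballE hbr) Nnorm_lt// => zs.
  have z1' : 1 - s < z.2.
    apply: le_lt_trans z1; rewrite -[leRHS]mul1r ler_pdivlMr;
      last by rewrite /s; lra.
    by rewrite -subr_sqr expr1n lerBlDr lerDl sqr_ge0.
  have zz : `|z.2 - 1| < s by rewrite ltr_norml; apply/andP; split; lra.
  have [e1 e2] := (enorm_ge0 z.1.1, enorm_ge0 z.1.2).
  have x1 : enorm z.1.1 < 2 * s.
    rewrite -(@ltr_pXn2r _ 4)// ?nnegrE ?mulr_ge0 ?ltW// exprMn.
    by have := sqr_ge0 (enorm z.1.2); move: zs; lra.
  have x2 : enorm z.1.2 < s ^+ 2.
    rewrite -(@ltr_pXn2r _ 2)// ?nnegrE ?exprn_ge0 ?ltW// -exprM -[(2 * 2)%N]/4%N.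
    by have := exprn_ge0 4 e1; move: zs; lra.
  apply: mem_Sball_id => //; move: zz x1 x2; rewrite /s; lra.
have b2 : (g1%:E <= rho (Scyl (Nball br Nid (expR 1)) (expR (- 2^-1)) (expR 2^-1)))%E.
  apply: le_trans h1 _; apply: le_rho => z /(Sball_id_bounded hbr).
  by rewrite mulfV.
have sD0 : 0 < s ^+ D by rewrite exprn_gt0.
have s1 : 0 < 1 + s by rewrite addr_gt0.
have s2 : (1 + s)^-1 < 1 + s.
  by apply: (@lt_trans _ _ 1); rewrite ?invf_lt1// ltrDl.
have c0 : 0 < ln (1 + s) - ln (1 + s)^-1.
  by rewrite subr_gt0 ltr_ln ?posrE ?invr_gt0.
move: b1 b2; rewrite rho_Scyl; last 2 first.
- by rewrite invr_gt0.
- exact: s2.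
rewrite rho_Scyl ?expR_gt0//; last by rewrite ltr_expR; lra.
rewrite (Nhaar_Nball s0) (Nhaar_Nball (expR_gt0 1)) -/D.
have := Nhaar_ge0 (Nball br Nid (1 : R)).
case: (Nhaar (Nball br Nid 1)) => [v| |//].
  rewrite lee_fin => v0 _; rewrite -!EFinM lee_fin => h; exists v => //.
  rewrite lt_def v0 andbT; apply/eqP => vE; move: h; rewrite vE !mulr0; lra.
by move=> _; rewrite mulry gtr0_sg// mul1e mulry gtr0_sg// mul1e leye_eq.
Qed.

End volume.

Lemma powR_expR (R : realType) (a x : R) : 0 < a -> a `^ x = expR (x * ln a).
Proof. by move=> a0; rewrite /powR gt_eqF. Qed.

(** * Small Riemannian balls: parts (i) and (ii) *)

Section small_balls.
Context {R : realType} {dv dz : nat}.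
Local Notation V := 'rV[R]_dv.
Local Notation Z := 'rV[R]_dz.
Local Notation N := (V * Z)%type.

Variable br : N -> N -> N.
Hypothesis hbr : Htype_algebra br.
Variables g1 g2 : R.
Hypotheses (hg1 : 0 < g1) (hg2 : 0 < g2).
Local Notation n := (Sdim dv dz).
Local Notation Q := (Qdim R dv dz).
Hypothesis hg : forall r : R, 0 < r < 1 ->
  ((g1 * r ^+ n)%:E <= rho (Sball br Sid r) <= (g2 * r ^+ n)%:E)%E.

Lemma Nhaar_unit_Nball : exists2 v : R, 0 < v & Nhaar (Nball br Nid 1) = v%:E.
Proof.
have h : 0 < (2^-1 : R) < 1 by apply/andP; split; lra.
by apply: (Nhaar_Nball1 hbr _ (hg h)); rewrite mulr_gt0// exprn_gt0; case/andP: h.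
Qed.

Lemma rho_Sball_small (r : R) : 0 < r < 1 ->
  exists f : R, [/\ rho (Sball br Sid r) = f%:E, g1 * r ^+ n <= f & f <= g2 * r ^+ n].
Proof.
move=> /hg; case: (rho _) => [f|/andP[]//|/andP[]//].
by rewrite !lee_fin => /andP[? ?]; exists f.
Qed.

Lemma rho_Sball_bounded (r : R) : 0 < r ->
  exists2 m : R, 0 <= m & (rho (Sball br Sid r) <= m%:E)%E.
Proof.
move=> r0; have [v v0 vE] := Nhaar_unit_Nball.
exists (2 * r * (expR (2 * r) ^+ (dv + 2 * dz) * v)).
  by rewrite !mulr_ge0 ?exprn_ge0 ?expR_ge0 ?ltW.
apply: le_trans (le_rho (Sball_id_bounded hbr (r := r))) _.
rewrite rho_Scyl ?expR_gt0//; last by rewrite ltr_expR; lra.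
rewrite (Nhaar_Nball hbr (expR_gt0 _)) vE !expRK -!EFinM lee_fin.
have -> : r - - r = 2 * r by ring.
exact: lexx.
Qed.

Lemma rho_Sball x r : Sset x ->
  rho (Sball br x r) = ((x.2 `^ Q)%:E * rho (Sball br Sid r))%E.
Proof. by move=> x0; rewrite (Sball_ltrans hbr)// (rho_ltrans hbr). Qed.

(** If c r < 1 the bounds [hg] compare both balls. Otherwise (c r)^n >= 1, and m, a bound for the
    measure of the ball of radius c / 2 > c r at the identity, is at most m (c r)^n. The constant
    adds g2 and m to cover both cases. *)
Lemma rho_Sball_doubling (c : R) : 0 < c -> exists C : R, forall i, R0_dom i ->
  (rho (Sball br i.1 (c * i.2)) <= C%:E * rho (R0_set br i))%E.
Proof.
move=> c0; have [m m0 hm] := rho_Sball_bounded (divr_gt0 c0 (ltr0Sn R 1)).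
exists ((g2 + m) * c ^+ n / g1) => -[x r] [/= x0 /andP[r0 r1]].
have cr0 : 0 < c * r by rewrite mulr_gt0.
have a0 : 0 < x.2 `^ Q by rewrite powR_gt0.
have rs : 0 < r < 1 by apply/andP; split; lra.
have [f [fE f1 f2]] := rho_Sball_small rs.
change (rho (Sball br x (c * r)) <=
  ((g2 + m) * c ^+ n / g1)%:E * rho (Sball br x r))%E.
rewrite (rho_Sball (c * r) x0) (rho_Sball r x0) fE muleCA.
apply: lee_wpmul2l; first by rewrite lee_fin ltW.
rewrite -EFinM.
apply: (@le_trans _ _ ((g2 + m) * (c * r) ^+ n)%:E).
  have [cr1|cr1] := ltP (c * r) 1.
    have crs : 0 < c * r < 1 by rewrite cr0.
    have [f' [-> _ h]] := rho_Sball_small crs.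
    rewrite lee_fin; apply: (le_trans h); apply: ler_wpM2r; last by rewrite lerDl.
    by rewrite exprn_ge0// ltW.
  apply: (@le_trans _ _ m%:E).
    apply: le_trans hm; apply: le_rho; apply: le_Sball.
    by rewrite ler_pM2l// ltW.
  rewrite lee_fin; apply: (@le_trans _ _ ((g2 + m) * 1)).
    by rewrite mulr1 lerDr ltW.
  by apply: ler_wpM2l; [rewrite addr_ge0// ltW | exact: exprn_ege1].
rewrite lee_fin exprMn [leLHS]mulrA -[leRHS]mulrA.
apply: ler_wpM2l; first by rewrite mulr_ge0 ?exprn_ge0 ?addr_ge0 ?(ltW c0) ?(ltW hg2).
by rewrite mulrC ler_pdivlMr// mulrC.
Qed.

Lemma open_R0 : open_family R0_dom (R0_set br).
Proof. by move=> i [x0 _]; exact: (open_Sball hbr). Qed.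

Lemma nicely_ordered_R0_radius :
  nicely_ordered rho R0_dom (R0_set br) (fun i2 i1 => i2.2 <= i1.2)
    (fun i => Sball br i.1 (3 * i.2)).
Proof.
split; first exact: rho_Sball_doubling.
move=> [x1 r1] [x2 r2] [/= x10 _] [/= x20 _] r21 [y [/= y2 y1]] z z2.
rewrite /R0_set /= in y1 y2 z2.
have yz := Sball_trans (Sball_Sset y2) (Sball_sym hbr x20 y2) z2.
have xz := Sball_trans x10 y1 yz.
by apply: le_Sball xz; lra.
Qed.

(** From a_2^Q g1 r_2^n <= rho(B_2) <= 2 rho(B_1) <= 2 a_1^Q g2 r_1^n and a_1^Q <= e^Q a_2^Q one
    gets r_2 <= (2 e^Q g2 / g1)^(1/n) r_1. The triangle inequality through the common point and x_2
    yields r_1 + 2 r_2. *)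
Lemma nicely_ordered_R0_rho :
  nicely_ordered rho R0_dom (R0_set br)
    (fun i2 i1 => rho (R0_set br i2) <= 2%:E * rho (R0_set br i1))%E
    (fun i => Sball br i.1
       ((1 + 2 * (2 * expR Q * g2 / g1) `^ n%:R^-1) * i.2)).
Proof.
set k := 2 * expR Q * g2 / g1; have k0 : 0 < k.
  by rewrite /k !mulr_gt0 ?expR_gt0 ?invr_gt0.
set kn := k `^ n%:R^-1; have kn0 : 0 < kn by exact: powR_gt0.
have n0 : n != 0%N by rewrite /Sdim addn1.
have knn : kn ^+ n = k.
  by rewrite -powR_mulrn ?ltW// -powRrM mulVf ?pnatr_eq0// powRr1// ltW.
split; first by apply: rho_Sball_doubling; rewrite addr_gt0// mulr_gt0.
move=> [x1 r1] [x2 r2] [/= x10 /andP[r10 r1h]] [/= x20 /andP[r20 r2h]].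
change (rho (Sball br x2 r2) <= 2%:E * rho (Sball br x1 r1) ->
  Sball br x2 r2 `&` Sball br x1 r1 !=set0 ->
  Sball br x2 r2 `<=` Sball br x1 ((1 + 2 * kn) * r1))%E.
move=> hrho [y [y2 y1]] z z2.
have y0 := Sball_Sset y2.
have h1 := Sball_ln hbr x10 y1; have h2 := Sball_ln hbr x20 y2.
have s1 : 0 < r1 < 1 by apply/andP; split; lra.
have s2 : 0 < r2 < 1 by apply/andP; split; lra.
have [f1 [f1E _ f1u]] := rho_Sball_small s1.
have [f2 [f2E f2l _]] := rho_Sball_small s2.
move: hrho; rewrite (rho_Sball r2 x20) (rho_Sball r1 x10) f1E f2E -!EFinM lee_fin.
have Q0 : 0 <= Q by rewrite divr_ge0.
have a10 : 0 < x1.2 `^ Q by rewrite powR_gt0.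
have a20 : 0 < x2.2 `^ Q by rewrite powR_gt0.
(* Through the common point, |ln a_1 - ln a_2| < r_1 + r_2 < 1, since both radii are below 1/2. *)
have aQ : x1.2 `^ Q <= expR Q * x2.2 `^ Q.
  rewrite !powR_expR// -expRD ler_expR -lerBlDr -mulrBr -[leRHS]mulr1.
  apply: ler_wpM2l => //; move: h1 h2;
    rewrite !ltr_norml => /andP[b1 _] /andP[_ b2].
  have r12 : r1 + r2 <= 1 by lra.
  have -> : ln x1.2 - ln x2.2 = - (ln y.2 - ln x1.2) + (ln y.2 - ln x2.2) by ring.
  by apply: le_trans r12; apply: lerD; apply: ltW; rewrite // ltrNl.
move=> hf.
have : g1 * r2 ^+ n <= 2 * expR Q * g2 * r1 ^+ n.
  rewrite -(ler_pM2l a20).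
  have := ler_wpM2l (ltW a20) f2l.
  have := ler_wpM2l (ltW a10) f1u.
  have := ler_wpM2r (mulr_ge0 (ltW hg2) (exprn_ge0 n (ltW r10))) aQ.
  move: hf.
  lra.
rewrite -ler_pdivlMl// mulrA [g1^-1 * _]mulrC -/k -knn -exprMn.
have kr0 : 0 <= kn * r1 by rewrite mulr_ge0 ?(ltW kn0) ?(ltW r10).
rewrite ler_pXn2r ?nnegrE ?(ltW r20)// ?lt0n// => r21.
have yz := Sball_trans y0 (Sball_sym hbr x20 y2) z2.
have xz := Sball_trans x10 y1 yz.
by apply: le_Sball xz; lra.
Qed.

End small_balls.

(** * The sets x E_{r, b}: part (iii) *)

Section big_sets.
Context {R : realType}.

(* With e^H = a_2 / a_1 and L_i = ln r_i, the hypothesis on q is the comparison *)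
(* of the measures, and the conclusion bounds r_2 by a power of r_1, and        *)
(* (a_2 / a_1)^(1/2) r_2^(b_2) by a multiple of r_1^(b_1). If L_1 is large      *)
(* compared with L_2, the second bound comes from |H| < L_1 + L_2 only.         *)
Lemma Rinf_exponents (b' b'' b1 b2 q L1 L2 H : R) :
  2^-1 < b' -> b' < b1 < b'' -> b' < b2 < b'' -> 1 <= 2 * q ->
  1 <= L1 -> 1 <= L2 -> `|H| < L1 + L2 ->
  q * (H + 2 * b2 * L2) + ln L2 <= q * (2 * b1 * L1) + ln L1 ->
  L2 <= (2 * b'' + 1) / (2 * b' - 1) * L1 /\
  H / 2 + b2 * L2 <= ln ((2 * b'' + 1) / (2 * b' - 1)) + b1 * L1.
Proof.
move=> hb' /andP[b11 b12] /andP[b21 b22] q1 L11 L21 hH hrho.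
have d0 : 0 < 2 * b' - 1 by lra.
set th := (2 * b'' + 1) / (2 * b' - 1).
have thE : th * (2 * b' - 1) = 2 * b'' + 1 by rewrite divfK// gt_eqF.
have th1 : 1 < th by rewrite ltr_pdivlMr//; lra.
have q0 : 0 < q by lra.
have [HN HP] : - (L1 + L2) < H /\ H < L1 + L2.
  by move: hH; rewrite ltr_norml => /andP[].
split.
  have [L21'|L12] := leP L2 L1.
    by apply: le_trans L21' _; rewrite ler_peMl//; lra.
  have lnL : ln L1 <= ln L2 by rewrite ler_ln ?posrE; lra.
  have : q * (H + 2 * b2 * L2) <= q * (2 * b1 * L1) by lra.
  rewrite ler_pM2l// => h.
  (* With H > - (L1 + L2) the comparison becomes (2 b2 - 1) L2 < (2 b1 + 1) L1, where b' < b2 and b1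
     < b''. *)
  rewrite mulrAC ler_pdivlMr//.
  nra.
have lnth : 0 <= ln th by rewrite ln_ge0// ltW.
have [LL|LL] := leP L1 (th * L2).
  have lnL : ln L1 <= ln th + ln L2.
    have [L10 L20 th0] : [/\ 0 < L1, 0 < L2 & 0 < th] by split; lra.
    by rewrite -lnM ?posrE// ler_ln ?posrE// mulr_gt0.
  (* The comparison of measures bounds 2 q times this quantity by ln L1 - ln L2 <= ln th. When the
     quantity is positive, 2 q >= 1 allows the factor to be dropped. *)
  have [e0|e0] := leP (H / 2 + b2 * L2 - b1 * L1) 0; first by lra.
  have : (H / 2 + b2 * L2 - b1 * L1) * 1 <= (H / 2 + b2 * L2 - b1 * L1) * (2 * q).
    by rewrite ler_pM2l.
  lra.
suff : H / 2 + b2 * L2 <= b1 * L1 by lra.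
(* Then H / 2 + b2 L2 <= L1 / 2 + (b'' + 1/2) L2 <= L1 / 2 + (b' - 1/2) L1 = b' L1. *)
have : (2 * b'' + 1) * L2 <= (2 * b' - 1) * L1.
  rewrite -thE mulrAC [leRHS]mulrC ler_pM2r//; lra.
nra.
Qed.

Context {dv dz : nat}.
Local Notation V := 'rV[R]_dv.
Local Notation Z := 'rV[R]_dz.
Local Notation N := (V * Z)%type.
Local Notation G := (N * R)%type.

Variable br : N -> N -> N.
Hypothesis hbr : Htype_algebra br.
Local Notation Smul := (Smul br).
Local Notation Q := (Qdim R dv dz).
Local Notation D := (dv + 2 * dz)%N.
Variable v : R.
Hypotheses (v0 : 0 < v) (vE : Nhaar (Nball br Nid 1) = v%:E).

Lemma Smul_inv_split (x1 x2 y z : G) : Sset x1 -> Sset x2 -> Sset y ->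
  Smul (Sinv x1) z = Smul (Smul (Sinv x1) y)
    (Smul (Sinv (Smul (Sinv x2) y)) (Smul (Sinv x2) z)).
Proof.
move=> x10 x20 y0; rewrite (Smul_inv_mul hbr _ (Sset_inv x20) y0).
by rewrite -(Smul_assoc hbr _ (Sset_inv x10) y0) (SmulVK hbr).
Qed.

Lemma Qdim_ge : 1 <= 2 * Q.
Proof.
have D1 : (1 <= D)%N.
  case: (posnP dz) => [dz0|dz0].
    by rewrite dz0 muln0 addn0; exact: (br_abelian hbr dz0).
  by apply: leq_trans (leq_addl _ _); rewrite muln_gt0.
by rewrite /Qdim mulrC divfK// ler1n.
Qed.

Lemma natr_dimE : D%:R = 2 * Q.
Proof. by rewrite /Qdim mulrC divfK. Qed.

Lemma expR1_gt1 (r : R) : expR 1 <= r -> [/\ 0 < r, 1 < r & 1 <= ln r].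
Proof.
move=> er; have r0 : 0 < r by exact: lt_le_trans (expR_gt0 1) er.
have lr : 1 <= ln r by rewrite -[1]expRK ler_ln ?posrE ?expR_gt0.
by split=> //; rewrite -(lnK (x := r)) ?posrE// -expR0 ltr_expR; lra.
Qed.

Lemma rho_E_set (r b : R) : expR 1 <= r ->
  rho (E_set br r b) = (2 * ln r * ((r `^ b) ^+ D * v))%:E.
Proof.
move=> /expR1_gt1[r0 r1 _].
have rr : r^-1 < r by apply: (@lt_trans _ _ 1) => //; rewrite invf_lt1.
rewrite /E_set rho_Scyl ?invr_gt0//.
rewrite (Nhaar_Nball hbr (powR_gt0 b r0)) vE -!EFinM lnV ?posrE// opprK.
by congr ((_ * _)%:E); ring.
Qed.

Lemma rho_E_dil (g r b : R) : 0 < g -> expR 1 <= r ->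
  rho (E_dil br g r b) = (g ^+ D * g * (2 * ln r * ((r `^ b) ^+ D * v)))%:E.
Proof.
move=> g0 /expR1_gt1[r0 r1 lr1]; rewrite /E_dil rho_Scyl ?powR_gt0//; last first.
  by rewrite !powR_expR// ltr_expR ltr_pM2r; lra.
rewrite (Nhaar_Nball hbr (mulr_gt0 g0 (powR_gt0 b r0))) vE -!EFinM !ln_powR.
by rewrite exprMn; congr (_%:E); ring.
Qed.

Lemma mem_E_set (r b : R) y : Sset y -> 0 < r ->
  E_set br r b y <-> Nnorm y.1 < r `^ b /\ `|ln y.2| < ln r.
Proof.
move=> y0 r0; rewrite /E_set /Scyl /=.
by rewrite (NballE hbr) (interval1_ln r0 y0).
Qed.

Lemma mem_E_dil (g r b : R) y : Sset y -> 0 < r ->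
  E_dil br g r b y <-> Nnorm y.1 < g * r `^ b /\ `|ln y.2| < g * ln r.
Proof.
move=> y0 r0; rewrite /E_dil /Scyl /= powRN (NballE hbr).
by rewrite (interval1_ln (powR_gt0 g r0) y0) ln_powR.
Qed.

(** The logarithm puts the comparison of measures in the form of [Rinf_exponents]; the last summand
    is common to all the sets and cancels. *)
Lemma ln_rho_E (a r b : R) : 0 < a -> expR 1 <= r ->
  ln (a `^ Q * (2 * ln r * ((r `^ b) ^+ D * v))) =
  Q * (ln a + 2 * b * ln r) + ln (ln r) + (ln 2 + ln v).
Proof.
move=> a0 /expR1_gt1[r0 r1 lr1].
have L0 : 0 < ln r by lra.
have rb : 0 < r `^ b by exact: powR_gt0.
have rbD : 0 < (r `^ b) ^+ D by rewrite exprn_gt0.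
rewrite lnM ?posrE ?powR_gt0// ?mulr_gt0//.
rewrite lnM ?posrE ?mulr_gt0// lnM ?posrE// lnM ?posrE// ln_powR.
have -> : ln ((r `^ b) ^+ D) = 2 * Q * (b * ln r).
  by rewrite lnXn// ln_powR -natr_dimE mulr_natl.
ring.
Qed.

Lemma Rinf_dilated (b' b'' g : R) (i1 i2 : G * R * R) :
  2^-1 < b' -> (4 * b'' + 2 * b' + 1) / (2 * b' - 1) < g ->
  Rinf_dom b' b'' i1 -> Rinf_dom b' b'' i2 ->
  (rho (Rinf_set br i2) <= rho (Rinf_set br i1))%E ->
  Rinf_set br i2 `&` Rinf_set br i1 !=set0 ->
  Rinf_set br i2 `<=` Rinf_dil br g i1.
Proof.
case: i1 i2 => [[x1 r1] b1] [[x2 r2] b2] hb' hg [/= x10 er1 hb1] [/= x20 er2 hb2].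
change ((rho (ltrans br x2 (E_set br r2 b2)) <= rho (ltrans br x1 (E_set br r1 b1)))%E ->
  ltrans br x2 (E_set br r2 b2) `&` ltrans br x1 (E_set br r1 b1) !=set0 ->
  ltrans br x2 (E_set br r2 b2) `<=` ltrans br x1 (E_dil br g r1 b1)).
rewrite !(rho_ltrans hbr)// !rho_E_set// -!EFinM lee_fin.
have [r10 r1gt L1] := expR1_gt1 er1; have [r20 r2gt L2] := expR1_gt1 er2.
have pos (a r b : R) : 0 < a -> 0 < r -> 1 <= ln r ->
    0 < a `^ Q * (2 * ln r * ((r `^ b) ^+ D * v)).
  move=> a0 r0 Lr; have L0 : 0 < ln r by lra.
  by rewrite !mulr_gt0 ?powR_gt0 ?exprn_gt0 ?powR_gt0.
rewrite -ler_ln ?posrE ?pos// !ln_rho_E// => hrho [y [y2 y1]] z z2.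
rewrite !(ltransE hbr)// in y1 y2 z2 *.
have y0 : Sset y.
  have : 0 < (Smul (Sinv x1) y).2.
    by case: y1 => _ /andP[+ _]; apply: lt_trans; rewrite invr_gt0.
  by rewrite /= pmulr_rgt0// invr_gt0.
have z0 : Sset z.
  have : 0 < (Smul (Sinv x2) z).2.
    by case: z2 => _ /andP[+ _]; apply: lt_trans; rewrite invr_gt0.
  by rewrite /= pmulr_rgt0// invr_gt0.
have u0 : Sset (Smul (Sinv x1) y) by exact: (Sset_mul br (Sset_inv x10) y0).
have p0 : Sset (Smul (Sinv x2) y) by exact: (Sset_mul br (Sset_inv x20) y0).
have q0 : Sset (Smul (Sinv x2) z) by exact: (Sset_mul br (Sset_inv x20) z0).
have w0 : Sset (Smul (Sinv x1) z) by exact: (Sset_mul br (Sset_inv x10) z0).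
move: y1 y2 z2 => /(mem_E_set _ u0 r10)[u1 u2] /(mem_E_set _ p0 r20)[p1 p2].
move=> /(mem_E_set _ q0 r20)[q1 q2].
apply/(mem_E_dil _ _ w0 r10).
(* The height of y cancels, so |H| is bounded by the logarithmic heights of the two sets. *)
have HE : ln (Smul (Sinv x1) y).2 - ln (Smul (Sinv x2) y).2 = ln x2.2 - ln x1.2.
  rewrite /= !lnM ?posrE ?invr_gt0// !lnV ?posrE//; ring.
rewrite (Smul_inv_split z x10 x20 y0) in w0 *.
move: (Smul (Sinv x1) y) (Smul (Sinv x2) y) (Smul (Sinv x2) z) u0 p0 q0 w0
  u1 u2 p1 p2 q1 q2 HE => u p q u0 p0 q0 w0 u1 u2 p1 p2 q1 q2 HE.
set H := ln x2.2 - ln x1.2 in HE.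
have Hlt : `|H| < ln r1 + ln r2.
  by rewrite -HE; apply: le_lt_trans (ler_normB _ _) _; exact: ltrD.
have [C1 C2] : ln r2 <= (2 * b'' + 1) / (2 * b' - 1) * ln r1 /\
    H / 2 + b2 * ln r2 <= ln ((2 * b'' + 1) / (2 * b' - 1)) + b1 * ln r1.
  apply: (@Rinf_exponents b' b'' b1 b2 Q) => //; first exact: Qdim_ge.
  by move: hrho; rewrite /H; lra.
have d0 : 0 < 2 * b' - 1 by lra.
set th := (2 * b'' + 1) / (2 * b' - 1) in C1 C2.
have th0 : 0 < th.
  by rewrite divr_gt0//; case/andP: hb1 => h1 h2; lra.
(* The bound imposed on gamma is exactly 1 + 2 th. *)
have thg : 1 + 2 * th < g.
  by apply: le_lt_trans hg; rewrite le_eqVlt; apply/orP; left; apply/eqP;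
     rewrite /th; field; rewrite gt_eqF.
split; last first.
  have -> : ln (Smul u (Smul (Sinv p) q)).2 = H + ln q.2.
    rewrite -HE /= lnM ?posrE ?mulr_gt0 ?invr_gt0// lnM ?posrE ?invr_gt0//.
    by rewrite lnV ?posrE// addrA.
  apply: le_lt_trans (ler_normD _ _) _.
  have : (1 + 2 * th) * ln r1 <= g * ln r1 by apply: ler_wpM2r; [lra | exact: ltW].
  move: Hlt q2 C1; lra.
(* In u p^-1 q, the N-part p.1^-1 q.1 has norm at most 2 r2^b2 and is dilated by (u.2 / p.2)^(1/2) =
   e^(H/2). By [C2] the result is at most 2 th r1^b1. *)
rewrite (Smul_div1 hbr _ u0 p0); apply: le_lt_trans (Nnorm_mul hbr _ _) _.
rewrite Nnorm_dil ?sqrtr_ge0//.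
have N1 : Nnorm (Nmul br (Ninv p.1) q.1) <= 2 * r2 `^ b2.
  apply: le_trans (Nnorm_mul hbr _ _) _; rewrite Nnorm_inv; lra.
have sE : Num.sqrt (u.2 / p.2) = expR (H / 2).
  rewrite -HE; apply/eqP; rewrite -(@eqrXn2 _ 2)// ?sqrtr_ge0 ?expR_ge0//.
  rewrite sqr_sqrtr ?divr_ge0 ?ltW// -expRM_natr divfK//.
  by rewrite expRD expRN !lnK.
have N2 : Num.sqrt (u.2 / p.2) * r2 `^ b2 <= th * r1 `^ b1.
  by rewrite sE !powR_expR// -[th]lnK ?posrE// -!expRD ler_expR.
have N3 := ler_wpM2l (sqrtr_ge0 (u.2 / p.2)) N1.
have N4 : (1 + 2 * th) * r1 `^ b1 <= g * r1 `^ b1.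
  by rewrite ler_wpM2r ?powR_ge0// ltW.
move: u1 N2 N3 N4; lra.
Qed.

Lemma nicely_ordered_Rinf (b' b'' g : R) :
  2^-1 < b' -> b' < b'' -> (4 * b'' + 2 * b' + 1) / (2 * b' - 1) < g ->
  nicely_ordered rho (Rinf_dom b' b'') (Rinf_set br)
    (fun i2 i1 => rho (Rinf_set br i2) <= rho (Rinf_set br i1))%E
    (Rinf_dil br g).
Proof.
move=> hb' hb'' hg; have g0 : 0 < g.
  by apply: lt_trans hg; apply: divr_gt0; lra.
split; last by move=> i1 i2 d1 d2; exact: Rinf_dilated hb' hg d1 d2.
exists (g ^+ D * g) => -[[x r] b] [/= x0 er hb].
change (rho (ltrans br x (E_dil br g r b)) <=
  (g ^+ D * g)%:E * rho (ltrans br x (E_set br r b)))%E.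
rewrite !(rho_ltrans hbr)// rho_E_dil// rho_E_set// EFinM muleCA.
exact: lexx.
Qed.

Lemma open_Rinf (b' b'' : R) : open_family (Rinf_dom b' b'') (Rinf_set br).
Proof.
move=> [[x r] b] [/= x0 /expR1_gt1[r0 _ _] _].
apply: (open_ltrans hbr x0); apply: open_Scyl; apply: (open_Nball hbr).
exact: powR_gt0.
Qed.

End big_sets.

(** * Big admissible sets: part (iv) *)

Section dyadic.
Context {R : realType} {dv dz : nat}.
Local Notation V := 'rV[R]_dv.
Local Notation Z := 'rV[R]_dz.
Local Notation N := (V * Z)%type.

Variable br : N -> N -> N.
Variables (I : int -> Type) (Qs : forall k, I k -> set N).
Variables (eta cN CN : R) (M : nat) (ctr : forall k, I k -> N).
Hypothesis hQ : dyadic_sets br Qs eta cN CN M ctr.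
Variable beta : R.
Hypothesis hbeta : 3 / 2 < beta.

Let beta1_gt0 : 0 < beta - 1.
Proof. by have := hbeta; rewrite ltr_pdivrMr//; lra. Qed.

(** The record [dyadic_sets] does not contain the openness of the dyadic sets, so it enters as a
    premise. *)
Lemma open_Dinf : (forall k a, open (@Qs k a)) ->
  open_family (Dinf_dom eta beta) (Dinf_set Qs).
Proof. by move=> oQ i _; exact: open_Scyl. Qed.

Lemma mem_Scyl_ln (A : set N) (a r : R) y : 0 < a -> 0 < r ->
  Scyl A (a / r) (a * r) y <-> [/\ A y.1, 0 < y.2 & `|ln y.2 - ln a| < ln r].
Proof.
move=> a0 r0; split=> [[Ay h]|[Ay y0 h]].
  have y0 : 0 < y.2 by case/andP: h => + _; apply: lt_trans; rewrite divr_gt0.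
  by split=> //; rewrite -interval_ln.
by split=> //; rewrite interval_ln.
Qed.

Lemma rho_Scyl_ln (A : set N) (a r : R) : 0 < a -> 1 < r ->
  rho (Scyl A (a / r) (a * r)) = ((2 * ln r)%:E * Nhaar A)%E.
Proof.
move=> a0 r1; have r0 : 0 < r by exact: lt_trans r1.
rewrite rho_Scyl ?divr_gt0//; last first.
  by rewrite ltr_pM2l//; apply: (@lt_trans _ _ 1) => //; rewrite invf_lt1.
by rewrite lnM ?posrE// ln_div ?posrE//; congr (_%:E * _)%E; ring.
Qed.

(** On N the inclusion is nestedness, disjointness being excluded by the common point. For the
    heights, a_2^(1/2) r_2^beta <= eta^k_2 <= eta^k_1 < a_1^(1/2) r_1^(4 beta) is combined with the
    bound on a_1 / a_2 given by that point. *)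
Lemma Dinf_dilated i1 i2 : Dinf_dom eta beta i1 -> Dinf_dom eta beta i2 ->
  projT1 i2.1.1 <= projT1 i1.1.1 ->
  Dinf_set Qs i2 `&` Dinf_set Qs i1 !=set0 ->
  Dinf_set Qs i2 `<=` Dinf_dil Qs ((9 * beta + 1) / (beta - 1)) i1.
Proof.
have b0 := beta1_gt0.
case: i1 i2 => [[[k1 A1] a1] r1] [[[k2 A2] a2] r2].
move=> [/= a10 er1 /andP[_ h1]] [/= a20 er2 /andP[h2 _]] k21.
have [r10 r1gt L1] := expR1_gt1 er1; have [r20 r2gt L2] := expR1_gt1 er2.
set g := (9 * beta + 1) / (beta - 1).
change (Scyl (Qs A2) (a2 / r2) (a2 * r2) `&` Scyl (Qs A1) (a1 / r1) (a1 * r1) !=set0 ->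
  Scyl (Qs A2) (a2 / r2) (a2 * r2) `<=` Scyl (Qs A1) (a1 / r1 `^ g) (a1 * r1 `^ g)).
move=> [y [/(mem_Scyl_ln _ _ a20 r20)[yA2 y0 y2] /(mem_Scyl_ln _ _ a10 r10)[yA1 _ y1]]] z.
move=> /(mem_Scyl_ln _ _ a20 r20)[zA2 z0 z2].
apply/mem_Scyl_ln => //; first exact: powR_gt0.
split=> //.
  case: (dyadic_nested hQ k21 A1 A2) => [E|]; last exact.
  by have : (Qs A1 `&` Qs A2) y.1 by []; rewrite E.
have etak : eta ^ k2 <= eta ^ k1 by rewrite ler_weXz2l// ltW// (dyadic_eta hQ).
have h12 := le_lt_trans (le_trans h2 etak) h1.
have s1 : 0 < Num.sqrt a1 by rewrite sqrtr_gt0.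
have s2 : 0 < Num.sqrt a2 by rewrite sqrtr_gt0.
have lsq (a : R) : 0 < a -> ln (Num.sqrt a) = 2^-1 * ln a.
  by move=> a0; rewrite -powR12_sqrt ?ltW// ln_powR.
move: h12; rewrite -ltr_ln ?posrE ?mulr_gt0 ?powR_gt0//.
rewrite !lnM ?posrE ?powR_gt0// !lsq// !ln_powR => h12.
have gE : g * (beta - 1) = 9 * beta + 1 by rewrite divfK// gt_eqF.
move: y1 y2 z2 L1 L2 h12 gE.
move: (ln y.2) (ln z.2) (ln a1) (ln a2) (ln r1) (ln r2) => Y Zt B1 B2 K1 K2.
clear -b0.
rewrite !ltr_norml => /andP[y1 y1'] /andP[y2 y2'] /andP[z1 z2] L1 L2 h gE.
have BB : B1 - B2 < K1 + K2 by lra.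
have : (beta - 2^-1) * K2 < (4 * beta + 2^-1) * K1 by lra.
(* The distance of ln z.2 from ln a_1 is below K1 + 2 K2. Multiplied by beta - 1, this sum is below
   ((beta - 1) + (8 beta + 2)) K1 = (9 beta + 1) K1, which is the origin of gamma. *)
move=> h'; have {}h' : 2 * ((beta - 1) * K2) < (8 * beta + 2) * K1 by lra.
have {}h' : (beta - 1) * (K1 + 2 * K2) < (beta - 1) * (g * K1).
  by rewrite mulrA [(beta - 1) * g]mulrC gE; lra.
rewrite ltr_pM2l// in h'.
apply/andP; split; lra.
Qed.

Lemma nicely_ordered_Dinf :
  nicely_ordered rho (Dinf_dom eta beta) (Dinf_set Qs)
    (fun i2 i1 => projT1 i2.1.1 <= projT1 i1.1.1)
    (Dinf_dil Qs ((9 * beta + 1) / (beta - 1))).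
Proof.
set g := (9 * beta + 1) / (beta - 1).
have g0 : 0 < g by apply: (divr_gt0 _ beta1_gt0); move: beta1_gt0; lra.
split; last by move=> i1 i2 ? ?; exact: Dinf_dilated.
(* Both cylinders have the same base, so the measures are in the ratio of ln (r^g) to ln r. *)
exists g => -[[[k A] a] r] [/= a0 er _]; have [r0 r1 L] := expR1_gt1 er.
change (rho (Scyl (Qs A) (a / r `^ g) (a * r `^ g)) <=
  g%:E * rho (Scyl (Qs A) (a / r) (a * r)))%E.
have rg : 1 < r `^ g by rewrite powR_expR// -expR0 ltr_expR; apply: mulr_gt0; lra.
rewrite !rho_Scyl_ln// ln_powR muleA -EFinM.
have -> : 2 * (g * ln r) = g * (2 * ln r) by ring.
exact: lexx.
Qed.

End dyadic.

Theorem lemma2p7 (R : realType) (dv dz : nat)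
    (br : 'rV[R]_dv * 'rV[R]_dz -> 'rV[R]_dv * 'rV[R]_dz ->
          'rV[R]_dv * 'rV[R]_dz)
    (hbr : Htype_algebra br)
    (g1 g2 : R) (hg1 : 0 < g1) (hg2 : 0 < g2)
    (hg : forall r : R, 0 < r < 1 ->
      ((g1 * r ^+ Sdim dv dz)%:E <= rho (Sball br Sid r)
        <= (g2 * r ^+ Sdim dv dz)%:E)%E) :
  [/\
      let le (i2 i1 : 'rV[R]_dv * 'rV[R]_dz * R * R) : Prop := i2.2 <= i1.2 in
      [/\ open_family R0_dom (R0_set br), preorder_on R0_dom le
        & nicely_ordered rho R0_dom (R0_set br) le
            (fun i => Sball br i.1 (3 * i.2))],
      let le (i2 i1 : 'rV[R]_dv * 'rV[R]_dz * R * R) : Prop :=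
        (rho (R0_set br i2) <= 2%:E * rho (R0_set br i1))%E in
      let g := 1 + 2 * (2 * expR (Qdim R dv dz) * g2 / g1)
                         `^ ((Sdim dv dz)%:R^-1) in
      open_family R0_dom (R0_set br) /\
      nicely_ordered rho R0_dom (R0_set br) le
        (fun i => Sball br i.1 (g * i.2)),
      forall b' b'' : R, 2^-1 < b' -> b' < b'' ->
      forall g : R, (4 * b'' + 2 * b' + 1) / (2 * b' - 1) < g ->
      let le (i2 i1 : 'rV[R]_dv * 'rV[R]_dz * R * R * R) : Prop :=
        (rho (Rinf_set br i2) <= rho (Rinf_set br i1))%E in
      [/\ open_family (Rinf_dom b' b'') (Rinf_set br),
          preorder_on (Rinf_dom b' b'') le
        & nicely_ordered rho (Rinf_dom b' b'') (Rinf_set br) le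
            (Rinf_dil br g)]
    &
      forall (I : int -> Type)
        (Q : forall k, I k -> set ('rV[R]_dv * 'rV[R]_dz))
        (eta cN CN : R) (M : nat)
        (ctr : forall k, I k -> 'rV[R]_dv * 'rV[R]_dz),
      dyadic_sets br Q eta cN CN M ctr ->
      forall c3 : R,
      (forall r : R, 1 < r ->
        Sball br Sid (ln r) `<=` Scyl (Nball br Nid (c3 * r)) r^-1 r) ->
      forall beta : R,
      Num.max (3 / 2) (Num.max (4^-1 + ln eta) (1 + ln (c3 / cN))) < beta ->
      let le (i2 i1 : {k : int & I k} * R * R) : Prop :=
        projT1 i2.1.1 <= projT1 i1.1.1 in
      let g := (9 * beta + 1) / (beta - 1) in
      [/\ (forall k a, open (Q k a)) ->
            open_family (Dinf_dom eta beta) (Dinf_set Q),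
          preorder_on (Dinf_dom eta beta) le
        & nicely_ordered rho (Dinf_dom eta beta) (Dinf_set Q) le
            (Dinf_dil Q g)]].
Proof.
split.
- split; first exact: (open_R0 hbr).
    by rewrite /preorder_on/=; split=> [i _|i j k _ _ _];
      [exact: lexx | exact: le_trans].
  exact: (nicely_ordered_R0_radius hbr hg1 hg2 hg).
(* With the factor 2 the relation is reflexive but not transitive, so no preorder is asserted
   here. *)
- split; first exact: (open_R0 hbr).
  exact: (nicely_ordered_R0_rho hbr hg1 hg2 hg).
- move=> b' b'' hb' hb'' g hgb le.
  have [v v0 vE] := Nhaar_unit_Nball hbr hg1 hg.
  split; first exact: (open_Rinf hbr).
    by rewrite /preorder_on/=; split=> [i _|i j k _ _ _];
      [exact: lexx | exact: le_trans].
  exact: (nicely_ordered_Rinf hbr v0 vE).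
- move=> I Q eta cN CN M ctr hQ c3 _ beta.
  rewrite gt_max => /andP[hbeta _] le g.
  split; first exact: open_Dinf.
    by rewrite /preorder_on/=; split=> [i _|i j k _ _ _];
      [exact: lexx | exact: le_trans].
  exact: (nicely_ordered_Dinf hQ hbeta).
Qed.
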